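(* For $d\in\{4,5\}$ let $\pi_d:\mathbb{R}^{d+1}\to\mathbb{R}^d$ denote the projection onto the first $d$ coordinates, and let $\Delta_4\subseteq\mathbb{R}^5$ and $\Delta_5\subseteq\mathbb{R}^6$ be the explicit simplices defined in the context. Then $\pi_4(\Delta_4)$ and $\pi_5(\Delta_5)$ are lattice-free simplices with $$\operatorname{lw}(\pi_4(\Delta_4))=2+2\sqrt{1+\frac{2}{\sqrt5}}\qquad\text{and}\qquad \operatorname{lw}(\pi_5(\Delta_5))=5+\frac{2}{\sqrt3}.$$ Both of them are local maximizers of the lattice width among lattice-free convex bodies in the respective dimensions; that is, for $d=4$ and $d=5$ there is some $\varepsilon>0$ such that every lattice-free convex body $K\subseteq\mathbb{R}^d$ whose Hausdorff distance to $\pi_d(\Delta_d)$ is at most $\varepsilon$ satisfies $\operatorname{lw}(K)\le\operatorname{lw}(\pi_d(\Delta_d))$.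
   Context: A convex body in $\mathbb{R}^d$ is called lattice-free if it does not contain any point of $\mathbb{Z}^d$ in its interior. The lattice width of a convex body $K\subseteq\mathbb{R}^d$ is $$\operatorname{lw}(K):=\min\Big\{\max_{x\in K}\langle x,y\rangle-\min_{x\in K}\langle x,y\rangle : y\in\mathbb{Z}^d\setminus\{\mathbf{0}\}\Big\},$$ where $\langle\cdot,\cdot\rangle$ is the standard scalar product. For a vector $v$ and an integer $i\ge 0$, $\overrightarrow{v}^{i}$ denotes the vector arising from $v$ by cyclically shifting all entries $i$ positions to the right. Dimension $4$: $\Delta_4:=\operatorname{conv}\{\overrightarrow{v}^{1},\dots,\overrightarrow{v}^{5}\}$, where $v\in\mathbb{R}^5$ has entries $$v_1=\tfrac15\Big(7-2\sqrt5+2\sqrt{10+2\sqrt5}\Big),\quad v_2=v_4=\tfrac15\Big(-3+4\sqrt5-4\sqrt{5-2\sqrt5}\Big),$$ $$v_3=\tfrac15\Big(7-4\sqrt5+6\sqrt{5-2\sqrt5}\Big),\quad v_5=\tfrac15\Big(-3-2\sqrt5-2\sqrt{5+2\sqrt5}\Big).$$ Dimension $5$: $\Delta_5:=\operatorname{conv}\{\overrightarrow{v}^{1},\dots,\overrightarrow{v}^{6}\}$, where $v\in\mathbb{R}^6$ has entries $$v_1=\tfrac1{18}\big(57-7\sqrt3\big),\quad v_2=v_5=\tfrac13\big(4\sqrt3-5\big),\quad v_3=v_4=\tfrac1{18}\big(27-11\sqrt3\big),\quad v_6=\tfrac1{18}\big(-33-19\sqrt3\big).$$ *)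

(* Defs.v *)
From HB Require Import structures.
From mathcomp Require Import all_boot all_order all_algebra.
From mathcomp Require Import all_classical all_reals all_analysis.

Set Implicit Arguments.
Unset Strict Implicit.
Unset Printing Implicit Defensive.

Import Order.TTheory GRing.Theory Num.Theory.
Import numFieldNormedType.Exports.

Local Open Scope classical_set_scope.
Local Open Scope ring_scope.

Section LatticeWidth.
Context {R : realType} {d : nat}.
Implicit Types (u x : 'rV[R]_d) (y z : 'rV[int]_d) (K A B : set 'rV[R]_d).

Definition dotprod u x : R := \sum_i u 0 i * x 0 i.

Definition intvec z : 'rV[R]_d := map_mx intr z.

Definition convex_body K : Prop :=
  [/\ compact K, convex_set K & K° !=set0].

Definition lattice_free K : Prop := forall z, ~ K° (intvec z).

(* On a convex body the supremum, the infimum and (below, since the interior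
   is nonempty) the infimum over y are all attained, i.e. they are the
   maximum and the minima of the usual definition. *)
Definition width K y : R :=
  sup [set dotprod x (intvec y) | x in K] -
  inf [set dotprod x (intvec y) | x in K].

Definition lw K : R := inf [set width K y | y in [set y | y != 0]].

(* The canonical norm on 'rV[R]_d is the sup norm; the Hausdorff distance is
   taken with respect to the Euclidean norm. *)
Definition enorm u : R := Num.sqrt (dotprod u u).

Definition dist_to x B : R := inf [set enorm (x - b) | b in B].

Definition hausdorff_dist A B : R :=
  Num.max (sup [set dist_to a B | a in A]) (sup [set dist_to b A | b in B]).

Definition local_maximizer_lw K : Prop :=
  exists2 e : R, 0 < e &
    forall K', convex_body K' -> lattice_free K' ->
      hausdorff_dist K' K <= e -> lw K' <= lw K.

Definition convhull n (p : 'I_n -> 'rV[R]_d) : set 'rV[R]_d :=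
  [set x | exists c : 'I_n -> R,
     [/\ forall i, 0 <= c i, \sum_i c i = 1 & x = \sum_i c i *: p i]].

Definition affinely_independent n (p : 'I_n -> 'rV[R]_d) : Prop :=
  forall c : 'I_n -> R,
    \sum_i c i = 0 -> \sum_i c i *: p i = 0 -> forall i, c i = 0.

(* Full-dimensional simplices only: d + 1 vertices in R^d. *)
Definition is_simplex K : Prop :=
  exists p : 'I_d.+1 -> 'rV[R]_d, affinely_independent p /\ K = convhull p.

End LatticeWidth.

Section Simplices.
Context {R : realType}.

Definition proj_first d (x : 'rV[R]_d.+1) : 'rV[R]_d :=
  \row_(i < d) x 0 (widen_ord (leqnSn d) i).

(* Entry j of the result is entry j - 1 (cyclically) of the argument. *)
Definition cshift1 n (v : 'rV[R]_n) : 'rV[R]_n := \row_(j < n) v 0 (ord_pred j).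

Definition cshift n (i : nat) (v : 'rV[R]_n) : 'rV[R]_n := iter i (@cshift1 n) v.

Definition cyclic_hull n (v : 'rV[R]_n) : set 'rV[R]_n :=
  convhull (fun i : 'I_n => cshift i.+1 v).

(* Indices are 0-based: the entry v_1 is vec4 0 0, and so on. *)
Definition vec4 : 'rV[R]_5 := \row_(j < 5) nth 0
  [:: 5^-1 * (7 - 2 * Num.sqrt 5 + 2 * Num.sqrt (10 + 2 * Num.sqrt 5));
      5^-1 * (- 3 + 4 * Num.sqrt 5 - 4 * Num.sqrt (5 - 2 * Num.sqrt 5));
      5^-1 * (7 - 4 * Num.sqrt 5 + 6 * Num.sqrt (5 - 2 * Num.sqrt 5));
      5^-1 * (- 3 + 4 * Num.sqrt 5 - 4 * Num.sqrt (5 - 2 * Num.sqrt 5));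
      5^-1 * (- 3 - 2 * Num.sqrt 5 - 2 * Num.sqrt (5 + 2 * Num.sqrt 5))] j.

Definition vec5 : 'rV[R]_6 := \row_(j < 6) nth 0
  [:: 18^-1 * (57 - 7 * Num.sqrt 3);
      3^-1 * (4 * Num.sqrt 3 - 5);
      18^-1 * (27 - 11 * Num.sqrt 3);
      18^-1 * (27 - 11 * Num.sqrt 3);
      3^-1 * (4 * Num.sqrt 3 - 5);
      18^-1 * (- 33 - 19 * Num.sqrt 3)] j.

Definition Delta4 : set 'rV[R]_5 := cyclic_hull vec4.

Definition Delta5 : set 'rV[R]_6 := cyclic_hull vec5.

End Simplices.

Arguments Delta4 : clear implicits.
Arguments Delta5 : clear implicits.

(* Main.v *)
Require Import Defs.
From Stdlib Require Import ZArith.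
From mathcomp Require Import all_boot all_order all_algebra.
From mathcomp Require Import all_classical all_reals all_analysis.
From mathcomp Require Import ring lra zify ssrZ.

(** Both simplices are instances of one argument.  Write n = d + 1, let u_k be
the vertices and let p_i be the unit vectors of R^n, projected to R^d; each
facet contains one of the p_i in its relative interior.  Let sigma_i be the
functional x_0 + ... + x_i, and replace sigma_d, which is constant on the
hyperplane of the simplex, by 0.  All differences sigma_b - sigma_a have the same
width W on the simplex, and each of them attains its maximum only at the vertex
u_a and its minimum only at u_b.  With T k i = sigma_i(u_k) this reads
[edge T a b = W] for a != b.

Local maximality.  Let K be lattice-free and close to the simplex.  A point
outside K and arbitrarily close to p_i is cut off from K by an affine function.
Normalised to have sum 1, these n functions are the barycentric coordinates
of a simplex that contains K ([facet_matrix]).  Let A be the matrix of their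
values at the u_k, which is close to the identity, and let Q be its inverse; its
rows are the barycentric coordinates of the vertices of the new simplex, so K
has width at most edge (Q T) a b along sigma_b - sigma_a ([near_width_le]).
If lw K > W, then all these numbers exceed W by a fixed amount.  On the other
hand, the i-th function is almost nonpositive at p_i, that is, the diagonal of
P A is almost nonpositive, where row i of P holds the barycentric coordinates
of p_i with respect to the original simplex.  The two facts are incompatible by
[trace_bound], which bounds the trace of P A from below by a positive
multiple of the sum of the increments edge (Q T) a b - W.  Its reason is a
Lagrange multiplier rule with an automatic second-order condition.  There is a
symmetric matrix L with zero row sums and negative entries off the diagonal such
that P = T L up to a common shift of the rows.  Hence the first-order part of
the trace is the sum of the increments weighted by -L_ab / 2.  The
second-order part involves the bilinear form of -T on the vectors of sum 0, and
the symmetric part of this form is determined by the numbers edge T a b: as they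
are all equal to W, it is W / 2 times the scalar product.  So the
second-order part is nonnegative up to a small multiple of the increments.

The remaining claims are finite checks.  All numbers lie in Q(sqrt 3), or in
Q(a, b) with a = sqrt 5 and b = sqrt (5 - 2 a), so identities are verified by
integer arithmetic, and signs by rational bounds on a, b and a b.  An interior
lattice point would have small coordinates and positive barycentric coordinates;
all lattice points of a box violate the latter.  If an integer functional has
width less than W, then its coefficients, which are the differences of its
values at the p_i, are bounded, and all nonzero functionals with such
coefficients have two vertices whose values differ by W at least. *)

Set Implicit Arguments.
Unset Strict Implicit.
Unset Printing Implicit Defensive.

Import Order.TTheory GRing.Theory Num.Theory.
Import numFieldNormedType.Exports.

Local Open Scope classical_set_scope.
Local Open Scope ring_scope.
Delimit Scope Z_scope with cZ.

(** * A trace inequality for matrices near the identity *)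

Section EdgeForm.
Context {R : realFieldType} {n : nat}.
Implicit Types (X T A Q E P L : 'M[R]_n) (x y z : 'rV[R]_n).

(** If X k i is the value of a functional sigma_i at a point q_k, this is the
value of sigma_b - sigma_a at q_a minus its value at q_b.  It is also minus the
value of the quadratic form of X at the difference of two unit vectors. *)
Definition edge X a b : R := X a b + X b a - X a a - X b b.

Lemma edge_diag X a : edge X a a = 0.
Proof. by rewrite /edge; ring. Qed.

Lemma edgeB X T a b : edge (X - T) a b = edge X a b - edge T a b.
Proof. by rewrite /edge !mxE; ring. Qed.

Definition bil X x y : R := (x *m X *m y^T) 0 0.

Lemma bilE X x y : bil X x y = \sum_c \sum_d x 0 c * y 0 d * X c d.
Proof.
rewrite /bil !mxE exchange_big; apply: eq_bigr => d _ /=.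
rewrite !mxE mulr_suml; apply: eq_bigr => c _.
by ring.
Qed.

(** On vectors of sum 0, the symmetric part of a bilinear form depends only on
its values at differences of unit vectors. *)
Lemma bil_sym X x y : \sum_c x 0 c = 0 -> \sum_d y 0 d = 0 ->
  bil X x y + bil X y x = \sum_c \sum_d x 0 c * y 0 d * edge X c d.
Proof.
move=> x0 y0; rewrite !bilE [X in _ + X]exchange_big /= -big_split /=.
have -> : \sum_c \sum_d x 0 c * y 0 d * edge X c d =
  \sum_c \sum_d (x 0 c * y 0 d * X c d + y 0 d * x 0 c * X d c)
  - \sum_c (x 0 c * X c c) * (\sum_d y 0 d)
  - (\sum_c x 0 c) * \sum_d (y 0 d * X d d).
  rewrite mulr_suml -!sumrB; apply: eq_bigr => c _.
  rewrite !mulr_sumr -!sumrB; apply: eq_bigr => d _.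
  by rewrite /edge; ring.
rewrite x0 y0 mul0r subr0 [X in _ - X]big1 ?subr0; last first.
  by move=> c _; rewrite mulr0.
by apply: eq_bigr => c _; rewrite -big_split.
Qed.

Lemma bil_quad X x : \sum_c x 0 c = 0 ->
  bil X x x = 2^-1 * \sum_c \sum_d x 0 c * x 0 d * edge X c d.
Proof. by move=> x0; rewrite -bil_sym //; field. Qed.

(** A symmetric matrix with zero row sums is a weighted graph Laplacian, that is,
a combination of the rank one forms of the differences of unit vectors. *)
Lemma tr_laplacian L X : L^T = L -> (forall a, \sum_b L a b = 0) ->
  \tr (L *m X) = 2^-1 * \sum_a \sum_b L a b * edge X a b.
Proof.
move=> symL sumL.
have trE : \tr (L *m X) = \sum_a \sum_b L a b * X a b.
  rewrite /mxtrace exchange_big /=; apply: eq_bigr => a _.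
  by rewrite !mxE; apply: eq_bigr => b _; rewrite -{1}symL mxE.
have Lab a b : L a b = L b a by rewrite -{1}symL mxE.
have -> : \sum_a \sum_b L a b * edge X a b =
  \sum_a \sum_b (L a b * X a b) + \sum_a \sum_b (L a b * X b a)
  - \sum_a (\sum_b L a b) * X a a - \sum_b (\sum_a L a b) * X b b.
  under [X in _ - X]eq_bigr do rewrite mulr_suml.
  rewrite [X in _ - X]exchange_big /= -big_split -!sumrB /=.
  apply: eq_bigr => a _; rewrite mulr_suml -big_split -!sumrB /=.
  by apply: eq_bigr => b _; rewrite /edge; ring.
rewrite [X in _ - X]big1 ?subr0; last first.
  move=> b _; under eq_bigr do rewrite Lab.
  by rewrite sumL mul0r.
rewrite [X in _ - X]big1 ?subr0; last by move=> b _; rewrite sumL mul0r.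
rewrite [X in _ + X]exchange_big /=.
under [X in _ + X]eq_bigr do under eq_bigr do rewrite Lab.
by rewrite -trE; field.
Qed.

Lemma bil_edge X a b :
  bil X (delta_mx 0 a - delta_mx 0 b) (delta_mx 0 a - delta_mx 0 b)
  = - edge X a b.
Proof.
rewrite /bil linearB /= !trmx_delta mulmxBr !mulmxBl -!rowE -!colE !mxE /edge.
by ring.
Qed.

End EdgeForm.

Section TraceBound.
Context {R : realFieldType} {n : nat}.
Variables (T P L A Q : 'M[R]_n) (v : 'rV[R]_n) (W c eta : R).
Hypothesis W_ge0 : 0 <= W.
Hypothesis edgeT : forall a b : 'I_n, a != b -> edge T a b = W.
Hypothesis symL : L^T = L.
Hypothesis sumL : forall a, \sum_b L a b = 0.
Hypothesis negL : forall a b : 'I_n, a != b -> L a b <= - c.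
Hypothesis c_ge0 : 0 <= c.
Hypothesis PE : P = T *m L + const_mx 1 *m v.
Hypothesis trP : \tr P = 0.
Hypothesis AQ : A *m Q = 1%:M.
Hypothesis A1 : forall i, \sum_j A i j = 1.
Hypothesis eta_le1 : eta <= 1.
Hypothesis Aeta : forall i j, `|A i j - (i == j)%:R| <= eta.
Hypothesis edgeQ : forall a b : 'I_n, a != b -> W <= edge (Q *m T) a b.

Let E : 'M[R]_n := A - 1%:M.
Let N : 'M[R]_n := Q *m T - T.
Let e (a b : 'I_n) : 'rV[R]_n := delta_mx 0 a - delta_mx 0 b.
Let f := edge N.
Let Phi := \sum_a \sum_b f a b.

Let f_ge0 a b : 0 <= f a b.
Proof.
rewrite /f; have [<-|ab] := eqVneq a b; first by rewrite edge_diag.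
by rewrite /N edgeB subr_ge0 edgeT ?edgeQ.
Qed.

Let sumE i : \sum_j E i j = 0.
Proof.
under eq_bigr do rewrite !mxE.
rewrite sumrB A1 (bigD1 i) //= eqxx big1 ?addr0 ?subrr // => j ji.
by rewrite eq_sym (negbTE ji).
Qed.

Let sum_e a b : \sum_j e a b 0 j = 0.
Proof.
under eq_bigr do rewrite !mxE /=.
rewrite sumrB (bigD1 a) //= eqxx big1 => [|j /negbTE -> //].
by rewrite (bigD1 b) //= eqxx big1 ?addr0 ?subrr // => j /negbTE ->.
Qed.

Let zE a b j : (e a b *m E) 0 j = E a j - E b j.
Proof. by rewrite mulmxBl -!rowE !mxE. Qed.

Let sum_z a b : \sum_j (e a b *m E) 0 j = 0.
Proof. by under eq_bigr do rewrite zE; rewrite sumrB !sumE subrr. Qed.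

Let z_le a b j : `|(e a b *m E) 0 j| <= 2 * eta.
Proof.
rewrite zE; apply: le_trans (ler_normB _ _) _.
by have := Aeta a j; have := Aeta b j; rewrite !mxE; lra.
Qed.

Let EX : E *m (Q *m T) = - N.
Proof. by rewrite mulmxA mulmxBl AQ mul1mx mulmxBl mul1mx opprB. Qed.

(** The contribution of T is minus W / 2 times the squared norm of x. *)
Let quad_le (x : 'rV[R]_n) : \sum_j x 0 j = 0 ->
  bil (Q *m T) x x <= 2^-1 * \sum_a \sum_b x 0 a * x 0 b * f a b.
Proof.
move=> x0; rewrite bil_quad //.
have -> : \sum_a \sum_b x 0 a * x 0 b * edge (Q *m T) a b =
  \sum_a \sum_b x 0 a * x 0 b * f a b + \sum_a \sum_b x 0 a * x 0 b * edge T a b.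
  rewrite -big_split; apply: eq_bigr => a _ /=; rewrite -big_split /=.
  by apply: eq_bigr => b _; rewrite /f edgeB; ring.
have -> : \sum_a \sum_b x 0 a * x 0 b * edge T a b = - (W * \sum_a x 0 a ^+ 2).
  have -> : \sum_a \sum_b x 0 a * x 0 b * edge T a b
    = \sum_a (x 0 a * W * (\sum_b x 0 b) - W * x 0 a ^+ 2).
    apply: eq_bigr => a _.
    rewrite (bigD1 a) //= edge_diag mulr0 add0r [in RHS](bigD1 a) //= mulrDr.
    under eq_bigr do rewrite edgeT 1?eq_sym // mulrAC.
    by rewrite -mulr_sumr; ring.
  rewrite x0 sumrB mulr_sumr big1 ?sub0r //.
  by move=> a _; rewrite mulr0.
have : 0 <= W * \sum_a x 0 a ^+ 2.
  by rewrite mulr_ge0 // sumr_ge0 // => a _; rewrite sqr_ge0.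
lra.
Qed.

Let e_le a b j : `|e a b 0 j| <= 1.
Proof.
rewrite !mxE /= ?eqxx /=; case: (j == a); case: (j == b) => /=;
  by rewrite ler_norml; apply/andP; split; lra.
Qed.

(** Exchanging z and e costs only entries of f, by [bil_sym], and e N z is minus
the quadratic form of Q T at z because E Q T = - N.  Since z is of order eta, all
remaining terms are of order eta times the sum of the increments. *)
Let cross_le a b : bil N (e a b *m E) (e a b) <= 4 * eta * Phi.
Proof.
pose z := e a b *m E; pose x := e a b; rewrite -/z -/x.
have bilxz : bil N x z = - bil (Q *m T) z z.
  have -> : N = - (E *m (Q *m T)) by rewrite EX opprK.
  by rewrite /bil mulmxN mulNmx [LHS]mxE !mulmxA.
have bilzx := bil_sym N (sum_z a b) (sum_e a b).
have quad := quad_le (sum_z a b).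
have /le_trans : bil N z x <=
    \sum_c \sum_d z 0 c * (x 0 d + 2^-1 * z 0 d) * f c d.
  have -> : \sum_c \sum_d z 0 c * (x 0 d + 2^-1 * z 0 d) * f c d =
     \sum_c \sum_d z 0 c * x 0 d * f c d
     + 2^-1 * \sum_c \sum_d z 0 c * z 0 d * f c d.
    rewrite mulr_sumr -big_split; apply: eq_bigr => i _ /=.
    rewrite mulr_sumr -big_split; apply: eq_bigr => j _ /=.
    by ring.
  by move: bilxz bilzx quad; rewrite -/z -/x; lra.
apply; rewrite /Phi mulr_sumr; apply: ler_sum => i _.
rewrite mulr_sumr; apply: ler_sum => j _.
apply: ler_wpM2r; first exact: f_ge0.
apply: le_trans (ler_norm _) _; rewrite normrM.
have -> : 4 * eta = 2 * eta * 2 by ring.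
apply: ler_pM => //; first exact: z_le.
apply: le_trans (ler_normD _ _) _.
have := e_le a b j; have := z_le a b j.
rewrite -/z -/x normrM (@ger0_norm _ 2^-1) ?invr_ge0 ?ler0n //.
by move: eta_le1; lra.
Qed.

(** With E = A - 1 and N = Q T - T, the stationarity of P gives
tr (P A) = tr (L E T) = - tr (L N) - tr (L E N).  The first term is the weighted
sum of the increments f = edge N.  The second one is a combination of the
products z N e, where e is a difference of two unit vectors and z = e E; these
are bounded by [cross_le]. *)
Lemma trace_bound :
  2^-1 * (c - 4 * eta * \sum_a \sum_(b | b != a) - L a b)
    * \sum_a \sum_b edge (Q *m T - T) a b <= \tr (P *m A).
Proof.
have -> : \tr (P *m A) = \tr (L *m (E *m T)).
  have -> : A = E + 1%:M by rewrite subrK.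
  rewrite mulmxDr mulmx1 mxtraceD trP addr0 PE mulmxDl mxtraceD.
  rewrite -!mulmxA [X in _ + X]mxtrace_mulC -[in X in _ + X]mulmxA.
  have -> : E *m (const_mx 1 : 'cV_n) = 0.
    apply/matrixP => i j; rewrite !mxE -[RHS](sumE i).
    by apply: eq_bigr => k _; rewrite [const_mx _ _ _]mxE mulr1.
  by rewrite mulmx0 mxtrace0 addr0 mxtrace_mulC mulmxA.
have -> : E *m T = - N - E *m N.
  have -> : E *m N = - N - E *m T by rewrite mulmxBr EX.
  by rewrite subKr.
rewrite tr_laplacian // -mulrA ler_pM2l ?invr_gt0 //.
have edgeE a b : edge (- N - E *m N) a b
    = - f a b + bil N (e a b *m E) (e a b).
  have -> : bil N (e a b *m E) (e a b) = bil (E *m N) (e a b) (e a b).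
    by rewrite /bil !mulmxA.
  by rewrite bil_edge /f /edge !mxE; ring.
have -> : (c - 4 * eta * \sum_a \sum_(b | b != a) - L a b) * Phi =
   \sum_a \sum_(b | b != a) (c * f a b - 4 * eta * Phi * - L a b).
  transitivity (\sum_a \sum_(b | b != a) (c * f a b)
                - \sum_a \sum_(b | b != a) 4 * eta * Phi * - L a b).
    rewrite mulrBl; congr (_ - _).
      rewrite mulr_sumr; apply: eq_bigr => a _.
      by rewrite (bigD1 a) //= /f edge_diag add0r mulr_sumr.
    rewrite mulrAC mulr_sumr; apply: eq_bigr => a _.
    by rewrite mulr_sumr.
  by rewrite -sumrB; apply: eq_bigr => a _; rewrite sumrB.
apply: ler_sum => a _.
rewrite [X in _ <= X](bigD1 a) //= edge_diag mulr0 add0r.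
apply: ler_sum => b ba; rewrite edgeE.
have ab : a != b by rewrite eq_sym.
have h1 := f_ge0 a b; have h2 := cross_le a b; have h3 := negL ab.
have h4 : 0 <= (- L a b - c) * f a b by rewrite mulr_ge0 //; lra.
have h5 : 0 <= (- L a b) * (4 * eta * Phi - bil N (e a b *m E) (e a b)).
  by rewrite mulr_ge0 ?subr_ge0 // oppr_ge0; apply: le_trans h3 _; rewrite oppr_le0.
rewrite -subr_ge0; have := addr_ge0 h4 h5.
by congr (0 <= _); ring.
Qed.

End TraceBound.

(** * Finite families and matrices near the identity *)

Section FiniteBounds.
Context {R : realFieldType}.

Lemma finite_lower_bound (I : finType) (f : I -> R) :
  (forall i, 0 < f i) -> exists2 c, 0 < c & forall i, c <= f i.
Proof.
move=> f0; exists (\big[Num.min/1]_i f i).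
  by elim/big_ind: _ => // x y x0 y0; rewrite lt_min x0.
by move=> i; rewrite (bigD1 i) //= ge_min lexx.
Qed.

Lemma finite_upper_bound (I : finType) (f : I -> R) :
  exists2 C, 0 < C & forall i, f i <= C.
Proof.
exists (1 + \sum_i `|f i|); first by rewrite ltr_wpDr ?ltr01 // sumr_ge0.
move=> i; apply: le_trans (ler_norm _) _; rewrite (bigD1 i) //= addrCA.
by rewrite lerDl addr_ge0 ?ler01 // sumr_ge0.
Qed.

(** Compare with a row in which the entry of X in column j has the largest
absolute value. *)
Lemma near_identity_bound n m (A : 'M[R]_n) (X B : 'M[R]_(n, m)) eta c :
    (forall i j, `|A i j - (i == j)%:R| <= eta) -> n%:R * eta <= 2^-1 ->
    A *m X = B -> (forall i j, `|B i j| <= c) ->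
  forall i j, `|X i j| <= 2 * c.
Proof.
move=> Aeta neta AX Bc i0 j.
have [k _ kmax] : exists2 k, true & forall i, `|X i j| <= `|X k j|.
  by case: (@arg_maxP _ R 'I_n i0 predT (fun i => `|X i j|)) => // k _ km;
     exists k => // i; exact: km.
suff : `|X k j| <= 2 * c by apply: le_trans; exact: kmax.
have Xk : X k j = B k j - \sum_l (A k l - (k == l)%:R) * X l j.
  under eq_bigr do rewrite mulrBl.
  rewrite sumrB -AX mxE opprB addrC subrK (bigD1 k) //= eqxx mul1r big1 ?addr0 //.
  by move=> l lk; rewrite eq_sym (negbTE lk) mul0r.
have sum_le : `|\sum_l (A k l - (k == l)%:R) * X l j| <= n%:R * eta * `|X k j|.
  apply: le_trans (ler_norm_sum _ _ _) _.
  apply: le_trans (_ : \sum_(l < n) eta * `|X k j| <= _).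
    by apply: ler_sum => l _; rewrite normrM ler_pM.
  by rewrite sumr_const card_ord -[X in X <= _]mulr_natl mulrA.
have h : `|X k j| <= `|B k j| + `|\sum_l (A k l - (k == l)%:R) * X l j|.
  by rewrite {1}Xk ler_normB.
have h2 : n%:R * eta * `|X k j| <= 2^-1 * `|X k j| by rewrite ler_wpM2r.
by have := Bc k j; lra.
Qed.

Lemma near_identity_dist n m (A : 'M[R]_n) (X B : 'M[R]_(n, m)) eta c :
    (forall i j, `|A i j - (i == j)%:R| <= eta) -> n%:R * eta <= 2^-1 ->
    A *m X = B -> (forall i j, `|B i j| <= c) ->
  forall i j, `|X i j - B i j| <= n%:R * eta * (2 * c).
Proof.
move=> Aeta neta AX Bc i j.
have XB := near_identity_bound Aeta neta AX Bc.
have -> : X i j - B i j = - \sum_l (A i l - (i == l)%:R) * X l j.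
  under eq_bigr do rewrite mulrBl.
  rewrite sumrB opprB -AX mxE; congr (_ - _).
  rewrite (bigD1 i) //= eqxx mul1r big1 ?addr0 // => l li.
  by rewrite eq_sym (negbTE li) mul0r.
rewrite normrN; apply: le_trans (ler_norm_sum _ _ _) _.
apply: le_trans (_ : \sum_(l < n) eta * (2 * c) <= _).
  by apply: ler_sum => l _; rewrite normrM ler_pM.
by rewrite sumr_const card_ord -[X in X <= _]mulr_natl mulrA.
Qed.

Lemma near_identity_unit n (A : 'M[R]_n) eta :
    (forall i j, `|A i j - (i == j)%:R| <= eta) -> n%:R * eta <= 2^-1 ->
  A \in unitmx.
Proof.
move=> Aeta neta.
rewrite -unitmx_tr -row_free_unit -kermx_eq0; apply/eqP/matrixP => i j.
have AX : A *m (kermx A^T)^T = 0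
    by apply: trmx_inj; rewrite trmx_mul trmxK mulmx_ker trmx0.
have B0 i' j' : `|(0 : 'M[R]_n) i' j'| <= 0 by rewrite mxE normr0.
have := near_identity_bound Aeta neta AX B0 j i.
by rewrite mulr0 normr_le0 !mxE => /eqP.
Qed.

End FiniteBounds.

(** * Separation, Hausdorff distance and lattice width *)

Section Convex.
Context {R : realType} {d : nat}.
Implicit Types (x y u w p : 'rV[R]_d) (K : set 'rV[R]_d).

Lemma dotprodC x y : dotprod x y = dotprod y x.
Proof. by apply: eq_bigr => i _; rewrite mulrC. Qed.

Lemma dotprodDr u x y : dotprod u (x + y) = dotprod u x + dotprod u y.
Proof. by rewrite -big_split; apply: eq_bigr => i _; rewrite mxE mulrDr. Qed.

Lemma dotprodZr u a x : dotprod u (a *: x) = a * dotprod u x.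
Proof. by rewrite mulr_sumr; apply: eq_bigr => i _; rewrite mxE mulrCA. Qed.

Lemma dotprodBr u x y : dotprod u (x - y) = dotprod u x - dotprod u y.
Proof. by rewrite dotprodDr -scaleN1r dotprodZr mulN1r. Qed.

Lemma dotprod_ge0 u : 0 <= dotprod u u.
Proof. by apply: sumr_ge0 => i _; rewrite -expr2 sqr_ge0. Qed.

Lemma dotprod_eq0 u : (dotprod u u == 0) = (u == 0).
Proof.
apply/eqP/eqP => [u0|->]; last by rewrite /dotprod big1 // => i _; rewrite mxE mul0r.
apply/rowP => i; rewrite mxE; apply/eqP; rewrite -sqrf_eq0 expr2.
by move/psumr_eq0P: u0 => -> // j _; rewrite -expr2 sqr_ge0.
Qed.

Lemma dotprod_continuous u : continuous (dotprod u : 'rV[R]_d -> R).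
Proof.
move=> x; have Fx := nbhs_filter x.
rewrite /continuous_at /dotprod.
apply: (@cvg_big R^o 'I_d +%R 0 xpredT (@add_continuous R^o) 'rV[R]_d (nbhs x)
  (index_enum 'I_d) (fun i (y : 'rV[R]_d) => u 0 i * y 0 i)
  (fun i => u 0 i * x 0 i) Fx) => i _.
by apply: cvgMl_tmp; exact: coord_continuous.
Qed.

Lemma convex_setP K : convex_set K -> forall t x y, 0 <= t -> t <= 1 ->
  K x -> K y -> K (t *: x + (1 - t) *: y).
Proof.
move=> cK t x y t0 t1 Kx Ky.
by have /set_mem := cK x y (Itv01 t0 t1) (mem_set Kx) (mem_set Ky).
Qed.

Lemma interior_rowP K p : K° p <->
  exists2 r, 0 < r & forall y, (forall i, `|p 0 i - y 0 i| < r) -> K y.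
Proof.
split=> [/nbhs_ballP [r /= r0 rK]|[r r0 rK]].
  exists r => // y py; apply: rK; split => // i j.
  by rewrite !ord1; exact: py.
apply/nbhs_ballP; exists r => //= y [_ py]; apply: rK => i; exact: py.
Qed.

Lemma dotprod_sqDZ u w t : dotprod (u + t *: w) (u + t *: w) =
  dotprod u u + 2 * t * dotprod u w + t ^+ 2 * dotprod w w :> R.
Proof.
rewrite /dotprod !mulr_sumr -!big_split; apply: eq_bigr => i _ /=.
by rewrite !mxE; ring.
Qed.

Lemma dotprod_sq_continuous p :
  continuous (fun x => dotprod (x - p) (x - p) : R).
Proof.
move=> x; have Fx := nbhs_filter x.
apply: (@cvg_big R^o 'I_d +%R 0 xpredT (@add_continuous R^o) 'rV[R]_d (nbhs x)
  (index_enum 'I_d) (fun i (y : 'rV[R]_d) => (y - p) 0 i * (y - p) 0 i)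
  (fun i => (x - p) 0 i * (x - p) 0 i) Fx) => i _.
have ci : (y - p) 0 i @[y --> x] --> (x - p) 0 i.
  under eq_cvg do rewrite !mxE.
  by rewrite !mxE; apply: cvgB; [exact: coord_continuous|exact: cvg_cst].
exact: cvgM.
Qed.

(** The separating functional points from p to the nearest point of K. *)
Lemma strict_separation K p : K !=set0 -> compact K -> convex_set K -> ~ K p ->
  exists w, forall x, K x -> dotprod w p < dotprod w x.
Proof.
move=> K0 cK convK Kp.
have [c /set_mem Kc cmin] := compact_EVT_min K0 cK
  (continuous_subspaceT (@dotprod_sq_continuous p)).
exists (c - p) => x Kx.
pose w := c - p; pose g := dotprod w (x - c); pose D := dotprod (x - c) (x - c).
have w_gt0 : 0 < dotprod w w.
  rewrite lt_def dotprod_ge0 andbT dotprod_eq0 subr_eq0.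
  by apply/eqP => cp; apply: Kp; rewrite -cp.
have D_ge0 : 0 <= D := dotprod_ge0 _.
suff g_ge0 : 0 <= g.
  rewrite -subr_gt0 -dotprodBr -(subrK c x) -addrA dotprodDr.
  exact: ltr_wpDl.
rewrite leNgt; apply/negP => g_lt0.
(* The squared distance to p along the segment from c to x is
     dotprod w w + 2 * t * g + t ^+ 2 * D; for this t it drops below its minimum. *)
pose t := - g / (D - g).
have den_gt0 : 0 < D - g by lra.
have t_gt0 : 0 < t by rewrite divr_gt0 // oppr_gt0.
have t_le1 : t <= 1 by rewrite ler_pdivrMr // mul1r; lra.
have tE : t * (D - g) = - g by rewrite divfK // gt_eqF.
have := cmin _ (mem_set (convex_setP convK (ltW t_gt0) t_le1 Kx Kc)).
have -> : t *: x + (1 - t) *: c - p = w + t *: (x - c).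
  by rewrite /w; apply/rowP => i; rewrite !mxE; ring.
rewrite dotprod_sqDZ -/w -/g -/D; nra.
Qed.

Lemma coord_le_enorm u i : `|u 0 i| <= enorm u.
Proof.
rewrite -sqrtr_sqr ler_wsqrtr // expr2 /dotprod (bigD1 i) //= lerDl.
by apply: sumr_ge0 => j _; rewrite -expr2 sqr_ge0.
Qed.

(** Boundedness in the form that makes the suprema and infima in [width]
meaningful. *)
Definition dot_bounded K := forall u, exists C, forall x, K x -> `|dotprod x u| <= C.

Lemma compact_dot_bounded K : compact K -> dot_bounded K.
Proof.
move=> cK u; have [K0|K0] := pselect (K !=set0); last first.
  by exists 0 => x Kx; exfalso; apply: K0; exists x.
have [a _ amin] := compact_EVT_min K0 cK
  (continuous_subspaceT (@dotprod_continuous u)).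
have [b _ bmax] := compact_EVT_max K0 cK
  (continuous_subspaceT (@dotprod_continuous u)).
exists (`|dotprod u a| + `|dotprod u b|) => x Kx; rewrite dotprodC.
have := amin x (mem_set Kx); have := bmax x (mem_set Kx).
have := ler_norm (dotprod u b); have := ler_norm (- dotprod u a).
have := normr_ge0 (dotprod u a); have := normr_ge0 (dotprod u b).
by rewrite normrN ler_norml => *; apply/andP; split; lra.
Qed.

Lemma dot_bounded_coord K : dot_bounded K ->
  exists C, forall x i, K x -> `|x 0 i| <= C.
Proof.
move=> bK.
have coordE x i : dotprod x (delta_mx 0 i) = x 0 i.
  rewrite /dotprod (bigD1 i) //= mxE !eqxx mulr1 big1 ?addr0 // => j ji.
  by rewrite mxE (negbTE ji) andbF mulr0.
have [c cE] := choice (fun i => bK (delta_mx 0 i)).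
have [C _ CE] := finite_upper_bound c.
by exists C => x i Kx; rewrite -coordE; exact: le_trans (cE i x Kx) (CE i).
Qed.

Lemma dist_to_le x z K : K z -> dist_to x K <= enorm (x - z).
Proof.
move=> Kz; apply: ge_inf; last by exists z.
by exists 0 => _ [b _ <-]; rewrite sqrtr_ge0.
Qed.

(** The infimum in [dist_to] need not be attained, hence the factor 2. *)
Lemma hausdorff_near K S e u : 0 < e -> K !=set0 -> dot_bounded S ->
  hausdorff_dist K S <= e -> S u ->
  exists2 z, K z & forall i, `|u 0 i - z 0 i| <= 2 * e.
Proof.
move=> e0 [k Kk] /dot_bounded_coord [C CE] KS Su.
have ubS : has_ubound [set dist_to b K | b in S].
  exists (Num.sqrt (\sum_i (C + `|k 0 i|) ^+ 2)) => _ [b Sb <-].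
  apply: le_trans (dist_to_le _ Kk) _; apply: ler_wsqrtr.
  apply: ler_sum => i _; rewrite -expr2 !mxE -[X in X <= _]real_normK ?num_real //.
  rewrite lerXn2r ?nnegrE ?addr_ge0 //; first exact: le_trans (CE b i Sb).
  by apply: le_trans (ler_normB _ _) _; rewrite lerD2r CE.
have uK : dist_to u K <= e.
  apply: le_trans KS; rewrite le_max; apply/orP; right.
  by apply: ub_le_sup => //; exists u.
have [_ [z Kz <-] zlt] : exists2 y, [set enorm (u - b) | b in K] y & y < dist_to u K + e.
  apply: inf_adherent => //; split; first by exists (enorm (u - k)), k.
  by exists 0 => _ [b _ <-]; rewrite sqrtr_ge0.
exists z => // i.
have := coord_le_enorm (u - z) i; rewrite !mxE; lra.
Qed.

Implicit Type h : 'rV[int]_d.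

Lemma width_ge K h x x' : dot_bounded K -> K x -> K x' ->
  dotprod x (intvec h) - dotprod x' (intvec h) <= width K h.
Proof.
move=> bK Kx Kx'; have [C CE] := bK (intvec h).
apply: lerB.
  apply: ub_le_sup; last by exists x.
  by exists C => _ [b Kb <-]; apply: le_trans (ler_norm _) (CE b Kb).
apply: ge_inf; last by exists x'.
exists (- C) => _ [b Kb <-].
by have := CE b Kb; rewrite ler_norml => /andP[].
Qed.

Lemma width_le K h a b : K !=set0 ->
  (forall x, K x -> b <= dotprod x (intvec h) <= a) -> width K h <= a - b.
Proof.
move=> [k Kk] ab; apply: lerB.
  apply: ge_sup; first by exists (dotprod k (intvec h)), k.
  by move=> _ [x Kx <-]; have /andP[] := ab x Kx.
apply: lb_le_inf; first by exists (dotprod k (intvec h)), k.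
by move=> _ [x Kx <-]; have /andP[] := ab x Kx.
Qed.

Lemma lw_le K h : K !=set0 -> dot_bounded K -> h != 0 -> lw K <= width K h.
Proof.
move=> [k Kk] bK y0; apply: ge_inf; last by exists h.
exists 0 => _ [z _ <-].
by have := width_ge z bK Kk Kk; rewrite subrr.
Qed.

End Convex.

(** * Simplices in barycentric coordinates *)

Section Lift.
Context {R : pzRingType} {d : nat}.

Lemma lift_ord_max (i : 'I_d) : lift ord_max i = widen_ord (leqnSn d) i.
Proof. by apply: val_inj; rewrite /= /bump leqNgt ltn_ord. Qed.

(** The inverse of [proj_first] on the hyperplane of vectors with sum 1. *)
Definition lift_pt (x : 'rV[R]_d) : 'rV[R]_d.+1 :=
  \row_j (if unlift ord_max j is Some i then x 0 i else 1 - \sum_i x 0 i).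

Lemma lift_pt_widen x i : lift_pt x 0 (widen_ord (leqnSn d) i) = x 0 i.
Proof.
by rewrite -lift_ord_max mxE liftK.
Qed.

Lemma lift_pt_max x : lift_pt x 0 ord_max = 1 - \sum_i x 0 i.
Proof. by rewrite mxE unlift_none. Qed.

Lemma lift_pt_sum x : \sum_j lift_pt x 0 j = 1.
Proof.
rewrite big_ord_recr /= lift_pt_max.
by under eq_bigr do rewrite lift_pt_widen; rewrite addrC subrK.
Qed.

Lemma lift_pt_unique (w : 'rV[R]_d.+1) (x : 'rV[R]_d) :
  \sum_j w 0 j = 1 -> (forall i, w 0 (widen_ord (leqnSn d) i) = x 0 i) ->
  lift_pt x = w.
Proof.
move=> w1 wx; apply/rowP => j; case: (unliftP ord_max j) => [i|] ->.
  by rewrite lift_ord_max lift_pt_widen wx.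
rewrite lift_pt_max -w1 big_ord_recr /=.
by under eq_bigr do rewrite wx; rewrite addrC addrK.
Qed.

End Lift.

Section Simplex.
Context {R : realType} {d : nat}.
Variables V P : 'M[R]_d.+1.
Hypothesis PV : P *m V = 1%:M.
Hypothesis Vsum : forall k, \sum_j V k j = 1.
Implicit Types (x y : 'rV[R]_d) (c : 'rV[R]_d.+1).

Definition vert k : 'rV[R]_d := proj_first (row k V).
Definition simplex : set 'rV[R]_d := @proj_first R d @` convhull (fun k => row k V).
(** As P is the inverse of the matrix V of the vertices, these are the barycentric
coordinates of the lifted point. *)
Definition bary x : 'rV[R]_d.+1 := lift_pt x *m P.
(** For i = d this is the origin, the projection of the last unit vector. *)
Definition unit_pt (i : 'I_d.+1) : 'rV[int]_d := \row_j ((j == i :> nat)%:R).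

Let VP : V *m P = 1%:M. Proof. exact: mulmx1C. Qed.

Lemma sum_mulV c : \sum_j (c *m V) 0 j = \sum_k c 0 k.
Proof.
under eq_bigr do rewrite mxE; rewrite exchange_big; apply: eq_bigr => k _.
by rewrite -mulr_sumr Vsum mulr1.
Qed.

Lemma baryK x : proj_first (bary x *m V) = x.
Proof.
by rewrite -mulmxA PV mulmx1; apply/rowP => i; rewrite mxE lift_pt_widen.
Qed.

Lemma bary_sum x : \sum_k bary x 0 k = 1.
Proof. by rewrite -sum_mulV -mulmxA PV mulmx1 lift_pt_sum. Qed.

Lemma bary_comb c : \sum_k c 0 k = 1 -> bary (proj_first (c *m V)) = c.
Proof.
move=> c1; rewrite /bary (@lift_pt_unique _ _ (c *m V)).
- by rewrite -mulmxA VP mulmx1.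
- by rewrite sum_mulV.
- by move=> i; rewrite [RHS]mxE.
Qed.

Lemma comb_vert c : proj_first (c *m V) = \sum_k c 0 k *: vert k.
Proof.
apply/rowP => i; rewrite !mxE summxE; apply: eq_bigr => k _.
by rewrite !mxE.
Qed.

Lemma comb_row c : \sum_k c 0 k *: row k V = c *m V.
Proof.
by apply/rowP => i; rewrite summxE mxE; apply: eq_bigr => k _; rewrite !mxE.
Qed.

Lemma bary_vert k : bary (vert k) = delta_mx 0 k.
Proof.
have -> : vert k = proj_first (delta_mx 0 k *m V) by rewrite -rowE.
apply: bary_comb; rewrite (bigD1 k) //= mxE !eqxx big1 ?addr0 // => j jk.
by rewrite mxE (negbTE jk) andbF.
Qed.

Lemma bary_unit_pt i : bary (intvec (unit_pt i)) = row i P.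
Proof.
rewrite rowE; congr (_ *m P); apply: lift_pt_unique.
  rewrite (bigD1 i) //= mxE !eqxx big1 ?addr0 // => j ji.
  by rewrite mxE (negbTE ji) andbF.
move=> j; rewrite !mxE eqxx /= -[in LHS](inj_eq val_inj) /=.
by case: eqP.
Qed.

Lemma dot_bary x u : dotprod x u = \sum_k bary x 0 k * dotprod (vert k) u.
Proof.
rewrite -{1}(baryK x) comb_vert dotprodC -[RHS]/(\sum_(k | xpredT k) _).
elim/big_rec2: _ => [|k a z _ <-].
  by rewrite /dotprod big1 // => i _; rewrite mxE mulr0.
by rewrite dotprodDr dotprodZr [dotprod u (vert k)]dotprodC.
Qed.

Lemma bary_line x y t : bary (x + t *: (x - y)) = bary x + t *: (bary x - bary y).
Proof.
transitivity ((lift_pt x + t *: (lift_pt x - lift_pt y)) *m P); last first.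
  by rewrite mulmxDl -scalemxAl mulmxBl.
congr (_ *m _).
have lineE j : (lift_pt x + t *: (lift_pt x - lift_pt y)) 0 j
    = lift_pt x 0 j + t * (lift_pt x 0 j - lift_pt y 0 j).
  by move: (lift_pt x) (lift_pt y) => a b; rewrite !mxE.
apply: lift_pt_unique.
  under eq_bigr do rewrite lineE.
  by rewrite big_split /= -mulr_sumr sumrB !lift_pt_sum subrr mulr0 addr0.
by move=> i; rewrite lineE !lift_pt_widen !mxE.
Qed.

Lemma bary_dist : exists2 C, 0 < C & forall x y r k, 0 <= r ->
  (forall i, `|x 0 i - y 0 i| <= r) -> `|bary x 0 k - bary y 0 k| <= C * r.
Proof.
have [C C0 CE] := finite_upper_bound (fun ik : 'I_d.+1 * 'I_d.+1 => `|P ik.1 ik.2|).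
exists (d.+1%:R * (d.+1%:R * C)); first by rewrite !mulr_gt0 // ltr0n.
move=> x y r k r0 xy.
have lift_dist j : `|lift_pt x 0 j - lift_pt y 0 j| <= d.+1%:R * r.
  rewrite !mxE; case: unliftP => [i _|_].
    by apply: le_trans (xy i) _; rewrite ler_peMl // ler1n.
  have subE (a b : R) : 1 - a - (1 - b) = b - a by ring.
  rewrite subE -sumrB.
  apply: le_trans (ler_norm_sum _ _ _) _.
  apply: le_trans (_ : \sum_(i < d) r <= _).
    by apply: ler_sum => i _; rewrite distrC.
  by rewrite sumr_const card_ord -[X in X <= _]mulr_natl ler_wpM2r // ler_nat.
rewrite !mxE -sumrB; apply: le_trans (ler_norm_sum _ _ _) _.
apply: le_trans (_ : \sum_(j < d.+1) d.+1%:R * C * r <= _); last first.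
  by rewrite sumr_const card_ord -[X in X <= _]mulr_natl !mulrA.
apply: ler_sum => j _; rewrite -mulrBl normrM mulrAC.
by apply: ler_pM => //; exact: (CE (j, k)).
Qed.

Lemma simplexP x : simplex x <-> forall k, 0 <= bary x 0 k.
Proof.
split=> [[_ [c [c0 c1 ->]] <-] k|x0].
  have -> : \sum_i c i *: row i V = (\row_i c i) *m V.
    by rewrite -comb_row; apply: eq_bigr => i _; rewrite mxE.
  rewrite bary_comb ?mxE //.
  by under eq_bigr do rewrite mxE.
exists (bary x *m V); last exact: baryK.
exists (fun k => bary x 0 k); split => //; first exact: bary_sum.
by rewrite comb_row.
Qed.

(** An interior point can be moved a little away from the k-th vertex within the
simplex, so its k-th coordinate is not 0 yet. *)
Lemma interior_bary x : simplex° x -> forall k, 0 < bary x 0 k.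
Proof.
move=> /interior_rowP [r r0 rS] k.
have [C C0 CE] := finite_upper_bound (fun i => `|(x - vert k) 0 i|).
pose t := r / (2 * C).
have t0 : 0 < t by rewrite divr_gt0 // mulr_gt0.
have : simplex (x + t *: (x - vert k)).
  apply: rS => i; rewrite !mxE opprD addrA subrr add0r normrN normrM gtr0_norm //.
  apply: le_lt_trans (_ : t * C < r).
    by rewrite ler_pM2l //; have := CE i; rewrite !mxE.
  rewrite /t invfM mulrA divfK ?gt_eqF //.
  by rewrite ltr_pdivrMr // ltr_pMr // ltr1n.
move/simplexP => /(_ k); rewrite bary_line bary_vert.
move: (bary x) => b; rewrite !mxE !eqxx /= => h; have : 0 < (1 + t) * b 0 k by lra.
by rewrite pmulr_rgt0 // addr_gt0.
Qed.

Lemma simplex_vert k : simplex (vert k).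
Proof.
apply/simplexP => j; rewrite bary_vert mxE eqxx /=; exact: ler0n.
Qed.

Lemma simplex_dot_bounded : dot_bounded simplex.
Proof.
move=> u; exists (\sum_k `|dotprod (vert k) u|) => x /simplexP x0.
rewrite dot_bary; apply: le_trans (ler_norm_sum _ _ _) _.
apply: ler_sum => k _; rewrite normrM ler_piMl // ger0_norm //.
by rewrite -(bary_sum x) (bigD1 k) //= lerDl sumr_ge0.
Qed.

Lemma simplex_is_simplex : is_simplex simplex.
Proof.
exists vert; split.
  move=> c c0 cv k.
  pose w := (\row_i c i) *m V.
  have wS : \sum_j w 0 j = 0 by rewrite sum_mulV; under eq_bigr do rewrite mxE.
  have w0 : w = 0.
    have wi i : w 0 (widen_ord (leqnSn d) i) = 0.
      have -> : w 0 (widen_ord (leqnSn d) i) = proj_first w 0 i by rewrite [RHS]mxE.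
      have -> : proj_first w = 0; last by rewrite mxE.
      by rewrite comb_vert -[RHS]cv; apply: eq_bigr => j _; rewrite mxE.
    apply/rowP => j; rewrite [RHS]mxE; case: (unliftP ord_max j) => [i|] ->.
      by rewrite lift_ord_max.
    by move: wS; rewrite big_ord_recr /= big1 ?add0r.
  have : (w *m P) 0 k = 0 by rewrite w0 mul0mx mxE.
  by rewrite -mulmxA VP mulmx1 mxE.
apply/seteqP; split => x.
  move=> [_ [c [c0 c1 ->]] <-]; exists c; split => //.
  transitivity (proj_first ((\row_i c i) *m V)).
    by rewrite -comb_row; congr proj_first; apply: eq_bigr => i _; rewrite mxE.
  by rewrite comb_vert; apply: eq_bigr => i _; rewrite mxE.
move=> [c [c0 c1 ->]]; exists (\sum_i c i *: row i V); first by exists c.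
transitivity (proj_first ((\row_i c i) *m V)).
  by rewrite -comb_row; congr proj_first; apply: eq_bigr => i _; rewrite mxE.
by rewrite comb_vert; apply: eq_bigr => i _; rewrite mxE.
Qed.

End Simplex.

(** * Cutting off the lattice points on the facets *)

Lemma sum_norm_le (R : realFieldType) n (F : 'I_n -> R) r :
  (forall i, `|F i| <= r) -> `|\sum_i F i| <= n%:R * r.
Proof.
move=> Fr; apply: le_trans (ler_norm_sum _ _ _) _.
apply: le_trans (_ : \sum_(i < n) r <= _); first by apply: ler_sum => i _.
by rewrite sumr_const card_ord -[X in X <= _]mulr_natl.
Qed.

Section Facets.
Context {R : realType} {d : nat}.
Variables V P : 'M[R]_d.+1.
Hypothesis PV : P *m V = 1%:M.
Hypothesis Vsum : forall k, \sum_j V k j = 1.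
Hypothesis P_diag : forall i, P i i = 0.
Variables (K : set 'rV[R]_d) (z : 'I_d.+1 -> 'rV[R]_d) (t q : R).
Hypothesis q_gt0 : 0 < q.
Hypothesis Pq : forall i k, k != i -> q <= P i k.
Hypothesis Kcompact : compact K.
Hypothesis Kconvex : convex_set K.
Hypothesis Kfree : lattice_free K.
Hypothesis Kz : forall k, K (z k).
Hypothesis t_gt0 : 0 < t.
Hypothesis zt : forall k j, `|bary P (z k) 0 j - (j == k)%:R| <= t.

Let n : R := d.+1%:R.
Let eta := 2 * (n * t) / q + n * t.

Hypothesis n_eta : n * eta <= 2^-1.

Let val a x : R := \sum_k bary P x 0 k * a k.

Let n_gt0 : 0 < n. Proof. by rewrite ltr0n. Qed.
Let nt_gt0 : 0 < n * t. Proof. exact: mulr_gt0. Qed.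

Let nt_lt : n * t < eta.
Proof. by rewrite ltrDr divr_gt0 // mulr_gt0. Qed.

Let eta_gt0 : 0 < eta. Proof. exact: lt_trans nt_lt. Qed.

Let eta_lt1 : eta < 1.
Proof.
have n1 : 1 <= n by rewrite ler1n.
by have := ler_wpM2r (ltW eta_gt0) n1; move: n_eta; lra.
Qed.

(** A point p' outside K and close to p_i is separated from K by an affine
function; a k is its value at the k-th vertex, scaled to have sup norm 1.  It is
almost 0 at p_i, a convex combination with weights at least q of all vertices
but the i-th, and it is almost nonnegative at the vertices since K has points
near them.  Hence it almost vanishes at all vertices but the i-th. *)
Lemma facet_functional i r : 0 < r -> r <= n * t ->
  exists a : 'I_d.+1 -> R,
    [/\ a i = 1, forall k, k != i -> `|a k| <= eta,
        forall x, K x -> 0 <= \sum_k bary P x 0 k * a k &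
        \sum_k P i k * a k <= r].
Proof.
move=> r_gt0 r_le.
have [C C0 baryC] := bary_dist P.
have [p' Kp' pp'] : exists2 p', ~ K p' &
    forall j, `|intvec (unit_pt i) 0 j - p' 0 j| < r / n / C.
  apply: contrapT => no; apply: (Kfree (z := unit_pt i)).
  apply/interior_rowP; exists (r / n / C).
    by rewrite !divr_gt0.
  by move=> y py; apply: contrapT => Ky; apply: no; exists y.
have bary_p' k : `|P i k - bary P p' 0 k| <= r / n.
  have -> : P i k = bary P (intvec (unit_pt i)) 0 k by rewrite bary_unit_pt mxE.
  have /le_trans : `|bary P (intvec (unit_pt i)) 0 k - bary P p' 0 k|
      <= C * (r / n / C).
    by apply: baryC => [|j]; [rewrite !divr_ge0 // ltW|exact: ltW].
  by apply; rewrite mulrC divfK ?gt_eqF.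
have [w sep] := strict_separation (ex_intro _ _ (Kz i)) Kcompact Kconvex Kp'.
pose a0 k := dotprod w (vert V k) - dotprod w p'.
have a0E x : val a0 x = dotprod w x - dotprod w p'.
  rewrite /val; under eq_bigr do rewrite mulrBr.
  rewrite sumrB -mulr_suml (bary_sum PV Vsum) mul1r; congr (_ - _).
  rewrite dotprodC (dot_bary PV).
  by apply: eq_bigr => k _; rewrite dotprodC.
have [m _ mmax] : exists2 m, true & forall k, `|a0 k| <= `|a0 m|.
  by case: (@arg_maxP _ R 'I_d.+1 i predT (fun k => `|a0 k|)) => // m _ km;
     exists m => // k; exact: km.
have m_gt0 : 0 < `|a0 m|.
  rewrite lt_def normr_ge0 andbT; apply/eqP => m0.
  have := sep _ (Kz i); rewrite -subr_gt0 -a0E /val big1 ?ltxx // => k _.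
  have := mmax k; rewrite m0 normr_le0 => /eqP ->; exact: mulr0.
pose a k := a0 k / `|a0 m|.
have valE x : val a x = val a0 x / `|a0 m|.
  by rewrite /val mulr_suml; apply: eq_bigr => k _; rewrite mulrA.
have a_le1 k : `|a k| <= 1.
  by rewrite normrM normfV normr_id ler_pdivrMr // mul1r.
have a_m : `|a m| = 1 by rewrite normrM normfV normr_id divff // gt_eqF.
have Ka x : K x -> 0 <= val a x.
  by move=> /sep; rewrite -subr_gt0 -a0E valE => h; rewrite divr_ge0 ?ltW.
have Pa : \sum_k P i k * a k <= r.
  have -> : \sum_k P i k * a k = \sum_k (P i k - bary P p' 0 k) * a k + val a p'.
    by rewrite /val -big_split; apply: eq_bigr => k _ /=; rewrite mulrBl subrK.
  rewrite valE a0E subrr mul0r addr0; apply: le_trans (ler_norm _) _.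
  apply: le_trans (@sum_norm_le _ _ _ (r / n) _) _; last first.
    by rewrite mulrC divfK ?gt_eqF.
  by move=> k; rewrite normrM -[X in _ <= X]mulr1 ler_pM.
have za k : `|val a (z k) - a k| <= n * t.
  have -> : val a (z k) - a k = \sum_j (bary P (z k) 0 j - (j == k)%:R) * a j.
    rewrite /val; under [RHS]eq_bigr do rewrite mulrBl.
    rewrite sumrB; congr (_ - _); rewrite (bigD1 k) //= eqxx mul1r big1 ?addr0 //.
    by move=> j /negbTE ->; rewrite mul0r.
  by apply: sum_norm_le => j; rewrite normrM -[X in _ <= X]mulr1 ler_pM.
have zsum : \sum_k P i k * val a (z k) <= 2 * (n * t).
  have -> : \sum_k P i k * val a (z k) =
      \sum_k P i k * (val a (z k) - a k) + \sum_k P i k * a k.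
    by rewrite -big_split; apply: eq_bigr => k _ /=; rewrite mulrBr subrK.
  have P_ge0 k : 0 <= P i k.
    have [->|ki] := eqVneq k i; first by rewrite P_diag.
    exact: le_trans (ltW q_gt0) (Pq ki).
  have Psum : \sum_k P i k = 1.
    rewrite -(bary_sum PV Vsum (intvec (unit_pt i))).
    by apply: eq_bigr => k _; rewrite bary_unit_pt mxE.
  have : \sum_k P i k * (val a (z k) - a k) <= \sum_k P i k * (n * t).
    by apply: ler_sum => k _; rewrite ler_wpM2l // (le_trans (ler_norm _)).
  by rewrite -mulr_suml Psum mul1r; lra.
have zk_le k : k != i -> val a (z k) <= 2 * (n * t) / q.
  move=> ki; rewrite ler_pdivlMr // mulrC.
  apply: le_trans zsum; rewrite (bigD1 k) //=.
  have : 0 <= \sum_(j | j != k) P i j * val a (z j).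
    apply: sumr_ge0 => j _; rewrite mulr_ge0 ?Ka //.
    have [->|ji] := eqVneq j i; first by rewrite P_diag.
    exact: le_trans (ltW q_gt0) (Pq ji).
  have := ler_wpM2r (Ka _ (Kz k)) (Pq ki); lra.
have a_small k : k != i -> `|a k| <= eta.
  move=> ki; have := za k; have := zk_le k ki; have := Ka _ (Kz k).
  rewrite !ler_norml /eta => h1 h2 /andP[h3 h4].
  by apply/andP; split; move: nt_gt0; lra.
have mi : m = i.
  apply/eqP; apply/negP => /negP /a_small.
  by rewrite a_m leNgt eta_lt1.
exists a; split => //.
have := za i; have := Ka _ (Kz i); move: a_m; rewrite mi.
have nt1 := lt_trans nt_lt eta_lt1 => ai h1.
rewrite ler_norml => /andP[h2 h3].
by move: ai; case: (ger0P (a i)) => // a_lt0 ai; lra.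
Qed.

(** Collect the functionals of [facet_functional] as columns and rescale the
columns so that the functions have sum 1.  The scaling factors s solve a linear
system whose matrix is near the identity, so they are near 1. *)
Lemma facet_matrix r : 0 < r -> r <= n * t ->
  exists A : 'M[R]_d.+1,
    [/\ forall k, \sum_i A k i = 1,
        forall k i, `|A k i - (k == i)%:R| <= (2 * n + 1) * eta,
        forall x, K x -> forall i, 0 <= (bary P x *m A) 0 i &
        forall i, (P *m A) i i <= 2 * r].
Proof.
move=> r_gt0 r_le.
have [a aE] := choice (fun i => facet_functional i r_gt0 r_le).
pose A1 : 'M[R]_d.+1 := \matrix_(k, i) a i k.
have A1_near k i : `|A1 k i - (k == i)%:R| <= eta.
  rewrite mxE; have [ai ak _ _] := aE i.
  have [->|ki] := eqVneq k i; first by rewrite ai subrr normr0 ltW.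
  by rewrite subr0 ak.
have A1_unit := near_identity_unit A1_near n_eta.
pose s : 'cV[R]_d.+1 := invmx A1 *m const_mx 1.
have A1s : A1 *m s = const_mx 1 by rewrite mulmxA mulmxV // mul1mx.
have s_near i : `|s i 0 - 1| <= 2 * n * eta.
  have := near_identity_dist A1_near n_eta A1s (c := 1) _ i 0.
  rewrite [const_mx _ _ _]mxE.
  have -> : n * eta * (2 * 1) = 2 * n * eta by ring.
  by apply => k j; rewrite mxE normr1.
have s_bnd i : 0 <= s i 0 <= 2.
  have := s_near i; rewrite ler_norml => /andP[h1 h2].
  by apply/andP; split; move: n_eta; lra.
exists (\matrix_(k, i) (a i k * s i 0)); split.
- move=> k; have : (A1 *m s) k 0 = 1 by rewrite A1s mxE.
  by rewrite mxE => <-; apply: eq_bigr => i _; rewrite !mxE.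
- move=> k i.
  have -> : (\matrix_(k', i') (a i' k' * s i' 0)) k i - (k == i)%:R =
      A1 k i * (s i 0 - 1) + (A1 k i - (k == i)%:R).
    by rewrite !mxE; ring.
  have A1_le1 : `|A1 k i| <= 1.
    rewrite mxE; have [ai ak _ _] := aE i.
    have [->|ki] := eqVneq k i; first by rewrite ai normr1.
    by apply: le_trans (ak k ki) _; rewrite ltW.
  apply: le_trans (ler_normD _ _) _; rewrite mulrDl mul1r lerD //.
  by rewrite normrM -[X in _ <= X]mul1r ler_pM.
- move=> x Kx i; rewrite mxE; have [_ _ /(_ x Kx) aK _] := aE i.
  under eq_bigr do rewrite [X in _ * X]mxE mulrA.
  by rewrite -mulr_suml mulr_ge0 //; case/andP: (s_bnd i).
move=> i; rewrite mxE; under eq_bigr do rewrite [X in _ * X]mxE mulrA.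
rewrite -mulr_suml; have [_ _ _ Pa] := aE i; have /andP[s0 s2] := s_bnd i.
apply: le_trans (ler_wpM2r s0 Pa) _.
by rewrite mulrC ler_wpM2r // ltW.
Qed.

End Facets.

(** * Local maximality *)

Section LocalMaximum.
Context {R : realType} {d : nat}.
Variables (V P L : 'M[R]_d.+1) (v : 'rV[R]_d.+1) (sigma : 'I_d.+1 -> 'rV[int]_d) (W : R).

Definition vert_values : 'M[R]_d.+1 :=
  \matrix_(k, i) dotprod (vert V k) (intvec (sigma i)).
Let T := vert_values.

Hypothesis d_gt0 : (0 < d)%N.
Hypothesis PV : P *m V = 1%:M.
Hypothesis Vsum : forall k, \sum_j V k j = 1.
Hypothesis sigma_inj : injective sigma.
Hypothesis P_diag : forall i, P i i = 0.
Hypothesis P_gt0 : forall i k, k != i -> 0 < P i k.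
Hypothesis W_ge0 : 0 <= W.
Hypothesis edgeT : forall a b, a != b -> edge T a b = W.
Hypothesis gapT : forall a b k, a != b -> k != a -> T k b - T k a < T a b - T a a.
Hypothesis symL : L^T = L.
Hypothesis sumL : forall a, \sum_b L a b = 0.
Hypothesis negL : forall a b, a != b -> L a b < 0.
Hypothesis PE : P = T *m L + const_mx 1 *m v.

Let n : R := d.+1%:R.
Let n_gt0 : 0 < n. Proof. by rewrite ltr0n. Qed.

Section NearIdentity.
Variables (K : set 'rV[R]_d) (A Q : 'M[R]_d.+1) (eta tau gamma : R).
Hypothesis K0 : K !=set0.
Hypothesis AQ : A *m Q = 1%:M.
Hypothesis A1 : forall i, \sum_j A i j = 1.
Hypothesis Aeta : forall i j, `|A i j - (i == j)%:R| <= eta.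
Hypothesis n_eta : n * eta <= 2^-1.
Hypothesis KA : forall x, K x -> forall i, 0 <= (bary P x *m A) 0 i.
Hypothesis T_le : forall k a b, `|T k b - T k a| <= tau.
Hypothesis gamma_le : forall a b k, a != b -> k != a ->
  T k b - T k a + gamma <= T a b - T a a.
Hypothesis gamma_large : 4 * n ^+ 2 * eta * tau <= gamma.

Let D a b j := (Q *m T) j b - (Q *m T) j a.

(** D a b j is the value of sigma_b - sigma_a at the j-th vertex of the simplex
cut out by the columns of A. *)
Let D_near a b j : `|D a b j - (T j b - T j a)| <= 2 * n ^+ 2 * eta * tau.
Proof.
have Q_near i k : `|Q i k - (i == k)%:R| <= n * eta * (2 * 1).
  have := near_identity_dist Aeta n_eta AQ (c := 1) _ i k.
  rewrite !mxE; apply => a' b'; rewrite mxE.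
  by case: (a' == b'); rewrite ?normr1 ?normr0.
have -> : D a b j - (T j b - T j a) =
    \sum_k (Q j k - (j == k)%:R) * (T k b - T k a).
  under eq_bigr do rewrite mulrBl mulrBr.
  rewrite sumrB [X in _ = _ - X](bigD1 j) //= eqxx mul1r.
  rewrite [X in _ = _ - (_ + X)]big1 ?addr0; last first.
    by move=> k kj; rewrite eq_sym (negbTE kj) mul0r.
  by rewrite /D [(Q *m T) j b]mxE [(Q *m T) j a]mxE sumrB.
have -> : 2 * n ^+ 2 * eta * tau = n * (n * eta * (2 * 1) * tau) by ring.
by apply: sum_norm_le => k; rewrite normrM ler_pM.
Qed.

(** The extreme vertices of sigma_b - sigma_a are still the a-th and the b-th,
because the gaps to the other vertices exceed the perturbation. *)
Lemma near_width_le a b : a != b -> width K (sigma b - sigma a) <= edge (Q *m T) a b.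
Proof.
move=> ab; have -> : edge (Q *m T) a b = D a b a - D a b b by rewrite /edge /D; ring.
apply: width_le => // x Kx.
pose be := bary P x *m A.
have be_sum : \sum_i be 0 i = 1.
  rewrite /be; under eq_bigr do rewrite mxE.
  rewrite exchange_big -(bary_sum PV Vsum x); apply: eq_bigr => k _ /=.
  by rewrite -mulr_sumr A1 mulr1.
have -> : dotprod x (intvec (sigma b - sigma a)) = \sum_j be 0 j * D a b j.
  have -> : intvec (sigma b - sigma a) = intvec (sigma b) - intvec (sigma a) :> 'rV[R]_d.
    by apply/rowP => j; rewrite !mxE intrB.
  rewrite dotprodBr !(dot_bary PV x).
  have dE c : \sum_k bary P x 0 k * dotprod (vert V k) (intvec (sigma c))
      = \sum_j be 0 j * (Q *m T) j c.
    have -> : \sum_j be 0 j * (Q *m T) j c = (be *m (Q *m T)) 0 c by rewrite [RHS]mxE.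
    rewrite /be -mulmxA [A *m _]mulmxA AQ mul1mx [RHS]mxE.
    by apply: eq_bigr => k _; rewrite [T _ _]mxE.
  by rewrite !dE -sumrB; apply: eq_bigr => j _; rewrite -mulrBr.
have be0 j : 0 <= be 0 j by exact: KA.
have Da j : D a b j <= D a b a.
  have [->//|ja] := eqVneq j a.
  have := D_near a b j; have := D_near a b a; have := gamma_le ab ja.
  by rewrite !ler_norml => h1 /andP[h2 h3] /andP[h4 h5]; move: gamma_large; lra.
have Db j : D a b b <= D a b j.
  have [->//|jb] := eqVneq j b.
  have ba : b != a by rewrite eq_sym.
  have := D_near a b j; have := D_near a b b; have := gamma_le ba jb.
  by rewrite !ler_norml => h1 /andP[h2 h3] /andP[h4 h5]; move: gamma_large; lra.
apply/andP; split.
  rewrite -[X in X <= _]mul1r -be_sum mulr_suml; apply: ler_sum => j _.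
  exact: ler_wpM2l.
rewrite -[X in _ <= X]mul1r -be_sum mulr_suml; apply: ler_sum => j _.
exact: ler_wpM2l.
Qed.

End NearIdentity.

(** The constants are chosen from the inside out: eta suits [trace_bound] and
[near_width_le], eta' is the accuracy of the facet functionals that yields A
with accuracy eta, and t is the distance of K from the vertices, in barycentric
coordinates, that yields eta'.
The last parameter r, how closely p_i is cut off, depends on lw K - W. *)
Lemma simplex_local_max : exists2 e : R, 0 < e & forall K, convex_body K ->
  lattice_free K -> hausdorff_dist K (simplex V) <= e -> lw K <= W.
Proof.
have [q q0 qP] : exists2 q, 0 < q & forall i k, k != i -> q <= P i k.
  pose f (x : 'I_d.+1 * 'I_d.+1) := if x.2 == x.1 then 1 else P x.1 x.2.
  have [x|q q0 qE] := @finite_lower_bound R _ f.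
    by rewrite /f; case: eqVneq => // ki; exact: P_gt0.
  by exists q => // i k ki; have := qE (i, k); rewrite /f /= (negbTE ki).
have [cL cL0 cLE] : exists2 c, 0 < c & forall a b, a != b -> L a b <= - c.
  pose f (x : 'I_d.+1 * 'I_d.+1) := if x.1 == x.2 then 1 else - L x.1 x.2.
  have [x|c c0 cE] := @finite_lower_bound R _ f.
    by rewrite /f; case: eqVneq => // ab; rewrite oppr_gt0 negL.
  by exists c => // a b ab; have := cE (a, b); rewrite /f /= (negbTE ab) lerNr.
have [gamma gamma0 gammaE] : exists2 c, 0 < c & forall a b k, a != b -> k != a ->
    T k b - T k a + c <= T a b - T a a.
  pose f (x : 'I_d.+1 * 'I_d.+1 * 'I_d.+1) :=
    if (x.1.1 == x.1.2) || (x.2 == x.1.1) then 1 else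
      T x.1.1 x.1.2 - T x.1.1 x.1.1 - (T x.2 x.1.2 - T x.2 x.1.1).
  have [x|c c0 cE] := @finite_lower_bound R _ f.
    rewrite /f; case: eqVneq => //= ab; case: eqVneq => //= ka.
    by rewrite subr_gt0 gapT.
  exists c => // a b k ab ka; have := cE (a, b, k).
  by rewrite /f /= (negbTE ab) (negbTE ka) /=; lra.
have [tau tau0 tauE] : exists2 c, 0 < c & forall k a b, `|T k b - T k a| <= c.
  have [c c0 cE] := @finite_upper_bound R ('I_d.+1 * 'I_d.+1 * 'I_d.+1)%type
    (fun x => `|T x.1.1 x.1.2 - T x.1.1 x.2|).
  by exists c => // k a b; exact: (cE (k, b, a)).
pose Lam := \sum_a \sum_(b | b != a) - L a b.
have Lam0 : 0 <= Lam.
  apply: sumr_ge0 => a _; apply: sumr_ge0 => b ba.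
  by rewrite oppr_ge0 ltW // negL // eq_sym.
(* The summands of X are the four reciprocal bounds that eta has to meet. *)
pose X := 1 + 2 * n + 8 * Lam / cL + 4 * n ^+ 2 * tau / gamma.
have X1 : 0 <= 8 * Lam / cL by rewrite divr_ge0 ?mulr_ge0 // ltW.
have X2 : 0 <= 4 * n ^+ 2 * tau / gamma.
  by rewrite divr_ge0 ?mulr_ge0 ?sqr_ge0 // ltW.
have X0 : 0 < X by rewrite /X; move: n_gt0; lra.
pose eta := X^-1.
have eta0 : 0 < eta by rewrite invr_gt0.
have etaX : eta * X = 1 by rewrite mulVf // gt_eqF.
have eta_small Y : Y <= X -> eta * Y <= 1.
  by move=> YX; rewrite -etaX ler_pM2l.
have eta1 : eta <= 1.
  by have := eta_small 1; rewrite mulr1; apply; rewrite /X; move: n_gt0; lra.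
have n_eta : n * eta <= 2^-1.
  by have := eta_small (2 * n); rewrite /X => h; have : eta * (2 * n) <= 1;
     [apply: h; lra|lra].
have eta_Lam : 4 * eta * Lam <= cL / 2.
  have : eta * (8 * Lam / cL) <= 1 by apply: eta_small; rewrite /X; move: n_gt0; lra.
  by rewrite mulrA ler_pdivrMr // mul1r; lra.
have eta_gamma : 4 * n ^+ 2 * eta * tau <= gamma.
  have : eta * (4 * n ^+ 2 * tau / gamma) <= 1.
    by apply: eta_small; rewrite /X; move: n_gt0; lra.
  by rewrite mulrA ler_pdivrMr // mul1r; lra.
pose eta' := eta / (2 * n + 1).
have n21 : 0 < 2 * n + 1 by move: n_gt0; lra.
have etaE : (2 * n + 1) * eta' = eta by rewrite /eta' mulrC divfK // gt_eqF.
have eta'0 : 0 < eta' by rewrite divr_gt0.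
have n_eta' : n * eta' <= 2^-1.
  apply: le_trans n_eta; rewrite ler_pM2l // -etaE ler_peMl ?(ltW eta'0) //.
  by move: n_gt0; lra.
pose t := eta' / (n * (2 / q + 1)).
have q21 : 0 < 2 / q + 1 by rewrite ltr_wpDl // divr_ge0 // ltW.
have t0 : 0 < t by rewrite divr_gt0 // mulr_gt0.
have tE : 2 * (n * t) / q + n * t = eta'.
  rewrite -[RHS](@divfK _ (n * (2 / q + 1))) ?gt_eqF ?mulr_gt0 // -/t; ring.
have [C C0 baryC] := bary_dist P.
have e0 : 0 < t / C / 2 by apply: divr_gt0 => //; apply: divr_gt0.
exists (t / C / 2) => // K [Kcompact Kconvex [x0 /interior_subset Kx0]] Kfree KS.
have K0 : K !=set0 by exists x0.
have near k : exists z, K z /\ forall i, `|vert V k 0 i - z 0 i| <= 2 * (t / C / 2).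
  have [z Kz zk] := hausdorff_near e0 K0
    (simplex_dot_bounded PV Vsum) KS (simplex_vert PV Vsum k).
  by exists z.
have {near} [z zE] := choice near.
have Kz k : K (z k) by case: (zE k).
have zt k j : `|bary P (z k) 0 j - (j == k)%:R| <= t.
  have -> : (j == k)%:R = bary P (vert V k) 0 j.
    by rewrite (bary_vert PV Vsum) mxE eqxx.
  have [_ zk] := zE k.
  have /le_trans : `|bary P (z k) 0 j - bary P (vert V k) 0 j| <= C * (2 * (t / C / 2)).
    by apply: baryC => [|i]; [rewrite mulr_ge0 // ltW|rewrite distrC].
  by apply; have -> : C * (2 * (t / C / 2)) = t by field; rewrite gt_eqF.
rewrite leNgt; apply/negP => lwK; pose g := lw K - W.
have g0 : 0 < g by rewrite subr_gt0.
pose r := Num.min (n * t) (cL * g / (16 * n)).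
have r0 : 0 < r by rewrite lt_min (mulr_gt0 n_gt0 t0) divr_gt0 ?mulr_gt0.
have r_le : r <= n * t by rewrite ge_min lexx.
have n_eta'' : n * (2 * (n * t) / q + n * t) <= 2^-1 by rewrite tE.
have [A [A_sum A_near KA PA]] := facet_matrix PV Vsum P_diag q0 qP Kcompact
  Kconvex Kfree Kz t0 zt n_eta'' r0 r_le.
rewrite -/n tE etaE in A_near.
have A_unit := near_identity_unit A_near n_eta.
pose Q := invmx A.
have AQ : A *m Q = 1%:M by rewrite mulmxV.
have edgeQ b c : b != c -> W + g <= edge (Q *m T) b c.
  move=> bc; rewrite /g addrC subrK.
  apply: le_trans (near_width_le K0 AQ A_sum A_near n_eta KA tauE gammaE eta_gamma bc).
  apply: lw_le => //; first exact: compact_dot_bounded.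
  rewrite subr_eq0; apply/eqP => /sigma_inj cb.
  by move: bc; rewrite cb eqxx.
have trP : \tr P = 0 by rewrite /mxtrace big1.
have edgeW b c : b != c -> W <= edge (Q *m T) b c.
  by move=> bc; apply: le_trans (edgeQ b c bc); rewrite lerDl ltW.
have tr_ge := trace_bound W_ge0 edgeT symL sumL cLE (ltW cL0) PE trP AQ A_sum
  eta1 A_near edgeW; rewrite -/Lam in tr_ge.
have edge_g b c : b != c -> g <= edge (Q *m T - T) b c.
  by move=> bc; rewrite edgeB (edgeT bc) lerBrDl edgeQ.
have edge_0 b c : 0 <= edge (Q *m T - T) b c.
  have [->|/edge_g] := eqVneq b c; first by rewrite edge_diag.
  exact/le_trans/ltW.
have sum_ge : g <= \sum_a \sum_b edge (Q *m T - T) a b.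
  have max0 : ord_max != 0 :> 'I_d.+1 by rewrite -val_eqE /= -lt0n.
  rewrite (bigD1 ord_max) //= (bigD1 (0 : 'I_d.+1)) 1?eq_sym //=.
  apply: le_trans (edge_g _ _ max0) _; rewrite -addrA lerDl addr_ge0 //.
    by apply: sumr_ge0.
  by apply: sumr_ge0 => b _; apply: sumr_ge0.
have tr_le : \tr (P *m A) <= n * (2 * r).
  rewrite /mxtrace; apply: le_trans (_ : \sum_(i < d.+1) 2 * r <= _).
    by apply: ler_sum => i _; exact: PA.
  by rewrite sumr_const card_ord -[X in X <= _]mulr_natl.
have r_small : n * (2 * r) <= cL * g / 8.
  have -> : cL * g / 8 = n * (2 * (cL * g / (16 * n))).
    by field; rewrite gt_eqF.
  by rewrite !ler_pM2l // ge_min lexx orbT.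
have : cL / 4 * g <= 2^-1 * (cL - 4 * eta * Lam) * \sum_a \sum_b edge (Q *m T - T) a b.
  by apply: ler_pM => //; [rewrite divr_ge0 // ltW|exact: ltW|lra].
have : 0 < cL * g by rewrite mulr_gt0.
by lra.
Qed.

End LocalMaximum.

(** * Exact arithmetic in a tower of two square roots *)

Section ZEmbedding.
Context {R : realDomainType}.
Implicit Types x y : Z.

Definition zr x : R := (int_of_Z x)%:~R.

Lemma zrD x y : zr (x + y)%cZ = zr x + zr y.
Proof. by rewrite /zr -intrD -rmorphD. Qed.

Lemma zrN x : zr (- x)%cZ = - zr x.
Proof. by rewrite /zr -mulrNz -rmorphN. Qed.

Lemma zrM x y : zr (x * y)%cZ = zr x * zr y.
Proof. by rewrite /zr -intrM -rmorphM. Qed.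

Lemma zr_le x y : (x <= y)%cZ -> zr x <= zr y.
Proof. by rewrite /zr ler_int; lia. Qed.

Lemma zr_lt x y : (x < y)%cZ -> zr x < zr y.
Proof. by rewrite /zr ltr_int; lia. Qed.

Lemma zr_int (m : int) : zr (Z_of_int m) = m%:~R.
Proof. by rewrite /zr Z_of_intK. Qed.

End ZEmbedding.

(** Quad x0 x1 x2 x3 stands for x0 + x1 a + x2 b + x3 a b, where a^2 = A and
b^2 = B0 + B1 a with integers A, B0, B1. *)
Inductive quad := Quad of Z & Z & Z & Z.
Arguments Quad (_ _ _ _)%_cZ.

Definition q0 := Quad 0%cZ 0%cZ 0%cZ 0%cZ.
Definition qint x := Quad x 0 0 0.
Definition qadd p q := let: Quad p0 p1 p2 p3 := p in let: Quad q0 q1 q2 q3 := q in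
  Quad (p0 + q0) (p1 + q1) (p2 + q2) (p3 + q3).
Definition qopp p := let: Quad p0 p1 p2 p3 := p in Quad (- p0) (- p1) (- p2) (- p3).
Definition qsub p q := qadd p (qopp q).
Definition qscale c p := let: Quad p0 p1 p2 p3 := p in
  Quad (c * p0) (c * p1) (c * p2) (c * p3).
Definition qmul (A B0 B1 : Z) p q :=
  let: Quad p0 p1 p2 p3 := p in let: Quad q0 q1 q2 q3 := q in
  let r0 := (p2 * q2 + A * p3 * q3)%cZ in let r1 := (p2 * q3 + p3 * q2)%cZ in
  Quad (p0 * q0 + A * p1 * q1 + r0 * B0 + A * r1 * B1)
       (p0 * q1 + p1 * q0 + r0 * B1 + r1 * B0)
       (p0 * q2 + p2 * q0 + A * (p1 * q3 + p3 * q1))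
       (p0 * q3 + p3 * q0 + p1 * q2 + p2 * q1).
Definition qeqb p q := let: Quad p0 p1 p2 p3 := p in let: Quad q0 q1 q2 q3 := q in
  [&& p0 =? q0, p1 =? q1, p2 =? q2 & p3 =? q3]%cZ.
Definition qsum (f : nat -> quad) m := foldr (fun k s => qadd (f k) s) q0 (iota 0 m).
Fixpoint qdot (z : seq Z) (r : seq quad) :=
  if z is x :: z' then if r is p :: r' then qadd (qscale x p) (qdot z' r') else q0
  else q0.

(** The bounds on a, b and a b are integers in units of 1 / unitN. *)
Record bounds := Bounds { unitN : Z; lo_a : Z; hi_a : Z; lo_b : Z; hi_b : Z;
  lo_ab : Z; hi_ab : Z }.

Definition term_ub (x lo hi : Z) := (if 0 <=? x then x * hi else x * lo)%cZ.
Definition qub (bd : bounds) p := let: Quad p0 p1 p2 p3 := p in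
  (p0 * unitN bd + term_ub p1 (lo_a bd) (hi_a bd) + term_ub p2 (lo_b bd) (hi_b bd)
   + term_ub p3 (lo_ab bd) (hi_ab bd))%cZ.
Definition qle0 bd p := (qub bd p <=? 0)%cZ.
Definition qlt0 bd p := (qub bd p <? 0)%cZ.

Section QuadValue.
Context {R : realFieldType}.
Variables (A B0 B1 : Z) (bd : bounds) (a b : R).
Hypothesis a2 : a ^+ 2 = zr A.
Hypothesis b2 : b ^+ 2 = zr B0 + zr B1 * a.
Hypothesis N0 : (0 < unitN bd)%cZ.
Hypothesis boundsP : [/\ zr (lo_a bd) <= zr (unitN bd) * a <= zr (hi_a bd),
  zr (lo_b bd) <= zr (unitN bd) * b <= zr (hi_b bd) &
  zr (lo_ab bd) <= zr (unitN bd) * (a * b) <= zr (hi_ab bd)].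

Definition qev p : R := let: Quad p0 p1 p2 p3 := p in
  zr p0 + zr p1 * a + zr p2 * b + zr p3 * (a * b).

Lemma qev0 : qev q0 = 0.
Proof. by rewrite /qev /zr /= !mul0r !addr0. Qed.

Lemma qev_int x : qev (qint x) = zr x.
Proof. by rewrite /qev /zr /= !mul0r !addr0. Qed.

Lemma qevD p q : qev (qadd p q) = qev p + qev q.
Proof. by case: p q => [? ? ? ?] [? ? ? ?] /=; rewrite !zrD; ring. Qed.

Lemma qevN p : qev (qopp p) = - qev p.
Proof. by case: p => [? ? ? ?] /=; rewrite !zrN; ring. Qed.

Lemma qevB p q : qev (qsub p q) = qev p - qev q.
Proof. by rewrite qevD qevN. Qed.

Lemma qevZ c p : qev (qscale c p) = zr c * qev p.
Proof. by case: p => [? ? ? ?] /=; rewrite !zrM; ring. Qed.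

Lemma qevM p q : qev (qmul A B0 B1 p q) = qev p * qev q.
Proof.
case: p q => [p0 p1 p2 p3] [q0 q1 q2 q3] /=.
rewrite !(zrD, zrM) -a2.
have -> : zr B0 = b ^+ 2 - zr B1 * a by rewrite b2 addrK.
ring.
Qed.

Lemma qeqbP p q : qeqb p q -> qev p = qev q.
Proof.
by case: p q => [? ? ? ?] [? ? ? ?] /and4P[/Z.eqb_eq -> /Z.eqb_eq -> /Z.eqb_eq -> /Z.eqb_eq ->].
Qed.

Lemma qev_sum f m : qev (qsum f m) = \sum_(k < m) qev (f k).
Proof.
rewrite -(big_mkord xpredT (fun k => qev (f k))) /index_iota subn0 /qsum.
elim: (iota 0 m) => [|k s IH]; first by rewrite big_nil -[RHS]qev0.
by rewrite [LHS]qevD IH big_cons.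
Qed.

Lemma qev_dot z r : size z = size r ->
  qev (qdot z r) = \sum_(j < size z) zr (nth 0%cZ z j) * qev (nth q0 r j).
Proof.
elim: z r => [|x z IH] [|p r] // => [_|].
  by rewrite big_ord0 -[RHS]qev0.
by case=> /IH rec; rewrite [LHS]qevD qevZ rec [RHS]big_ord_recl.
Qed.

Lemma term_ubP x lo hi (y : R) : zr lo <= zr (unitN bd) * y <= zr hi ->
  zr (unitN bd) * (zr x * y) <= zr (term_ub x lo hi).
Proof.
move=> /andP[loy yhi]; rewrite /term_ub mulrCA.
case: Z.leb_spec => x0; rewrite zrM.
  by apply: ler_wpM2l => //; apply: (@zr_le R 0).
by apply: ler_wnM2l => //; apply: ltW; apply: (@zr_lt R _ 0).
Qed.

Lemma qubP p : zr (unitN bd) * qev p <= zr (qub bd p).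
Proof.
case: boundsP => ha hb hab; case: p => [p0 p1 p2 p3] /=.
rewrite !zrD zrM !mulrDr [zr p0 * _]mulrC.
by rewrite !lerD // term_ubP.
Qed.

Let N_gt0 : 0 < zr (unitN bd) :> R. Proof. exact: (@zr_lt R 0). Qed.

Lemma qle0P p : qle0 bd p -> qev p <= 0.
Proof.
move=> /Z.leb_le /(@zr_le R) h; rewrite -(pmulr_rle0 _ N_gt0).
exact: le_trans (qubP p) h.
Qed.

Lemma qlt0P p : qlt0 bd p -> qev p < 0.
Proof.
move=> /Z.ltb_lt /(@zr_lt R) h; rewrite -(pmulr_rlt0 _ N_gt0).
exact: le_lt_trans (qubP p) h.
Qed.

End QuadValue.

Definition zrange (lo : Z) (len : nat) := [seq (lo + Z.of_nat k)%cZ | k <- iota 0 len].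

Fixpoint box d (s : seq Z) : seq (seq Z) :=
  if d is d'.+1 then flatten [seq [seq x :: l | l <- box d' s] | x <- s] else [:: [::]].

Lemma mem_zrange lo len (x : Z) :
  (lo <= x)%cZ -> (x < lo + Z.of_nat len)%cZ -> x \in zrange lo len.
Proof.
move=> lox xhi; apply/mapP; exists (Z.to_nat (x - lo)); last by lia.
by rewrite mem_iota; lia.
Qed.

Lemma mem_box d s (l : seq Z) : size l = d -> {subset l <= s} -> l \in box d s.
Proof.
elim: d l => [|d IH] [|x l] //= [sl] ls.
apply/flatten_mapP; exists x; first by apply: ls; rewrite mem_head.
by apply: map_f; apply: IH => // y yl; apply: ls; rewrite inE yl orbT.
Qed.

Definition allb n (f : nat -> bool) := all f (iota 0 n).

Lemma allbP n f : allb n f -> forall i, (i < n)%N -> f i.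
Proof. by move=> /allP h i im; apply: h; rewrite mem_iota. Qed.

(** * Simplices given by exact data *)

(** [vq] is the vector whose cyclic shifts are the vertices, times [dV]; [pq] and
[lq] are the first rows of the circulant matrices P and L, times [dP] and
[dL]; [wq] is the width times [dV].  Lattice points in the simplex have their
coordinates in the [zlen] integers from [zlo] on, and functionals of width less
than W have coefficients of absolute value at most [ymax]. *)
Record cert := Cert {
  sqA : Z; sqB0 : Z; sqB1 : Z; bnd : bounds;
  vq : seq quad; dV : Z; pq : seq quad; dP : Z; lq : seq quad; dL : Z; wq : quad;
  zlo : Z; zlen : nat; ymax : nat }.

Section Check.
Variables (d : nat) (C : cert).
Let n := d.+1.
Let mul := qmul (sqA C) (sqB0 C) (sqB1 C).

Definition Vq k j := nth q0 (vq C) ((j + n - k.+1) %% n).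
Definition Pq i k := nth q0 (pq C) ((k + n - i) %% n).
Definition Lq i j := nth q0 (lq C) ((j + n - i) %% n).
(** The sum of all coordinates is constant on the hyperplane of the simplex, so
for i = d it is replaced by 0, which is a functional on R^d. *)
Definition Tq k i := if (i < d)%N then qsum (Vq k) i.+1 else q0.
Definition edgeq a b := qsub (qsub (qadd (Tq a b) (Tq b a)) (Tq a a)) (Tq b b).
Definition q_neg := qlt0 (bnd C).
Definition q_npos := qle0 (bnd C).
Definition q_lt p q := q_neg (qsub p q).
Definition q_pos_part p := if q_npos p then q0 else p.

Definition check_scales :=
  [&& (0 <? unitN (bnd C))%cZ, (0 <? dV C)%cZ, (0 <? dP C)%cZ & (0 <? dL C)%cZ].

Definition check_inverse := allb n (fun i => allb n (fun j =>
  qeqb (qsum (fun k => mul (Pq i k) (Vq k j)) n)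
       (qint (if i == j then (dP C * dV C)%cZ else 0%cZ)))).

Definition check_sum := allb n (fun k => qeqb (qsum (Vq k) n) (qint (dV C))).

Definition check_points := allb n (fun i => qeqb (Pq i i) q0 &&
  allb n (fun k => (k == i) || q_neg (qopp (Pq i k)))).

Definition check_edges := q_neg (qopp (wq C)) && allb n (fun a => allb n (fun b =>
  (a == b) || qeqb (edgeq a b) (wq C))).

Definition check_gaps := allb n (fun a => allb n (fun b => allb n (fun k =>
  [|| a == b, k == a | q_lt (qsub (Tq k b) (Tq k a)) (qsub (Tq a b) (Tq a a))]))).

Definition check_multipliers := allb n (fun i =>
  [&& qeqb (qsum (Lq i) n) q0, allb n (fun j => qeqb (Lq i j) (Lq j i)) &
      allb n (fun j => (i == j) || q_neg (Lq i j))]).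

(** Compared are the differences of the rows to the last row, since P = T L holds
only up to a shift that is common to all rows. *)
Definition check_stationary := allb n (fun i => allb n (fun k =>
  qeqb (qscale (dL C * dV C)%cZ (qsub (Pq i k) (Pq d k)))
       (qscale (dP C) (qsum (fun l => mul (qsub (Tq i l) (Tq d l)) (Lq l k)) n)))).

Definition check_coords := allb n (fun k => allb d (fun j =>
  q_lt (qint ((zlo C - 1) * dV C)%cZ) (Vq k j) &&
  q_lt (Vq k j) (qint ((zlo C + Z.of_nat (zlen C)) * dV C)%cZ))).

Definition check_lattice :=
  let forms := [seq (Pq d k, [seq qsub (Pq i k) (Pq d k) | i <- iota 0 d]) | k <- iota 0 n] in
  all (fun z => has (fun f => q_npos (qadd f.1 (qdot z f.2))) forms)
      (box d (zrange (zlo C) (zlen C))).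

(** If the values of y at the vertices lie in [m, m + W], then y_i - y_j is at most
W times the sum of the positive parts of P_ik - P_jk. *)
Definition check_coef_bound := allb n (fun i => allb n (fun j =>
  allb n (fun k => q_npos (qsub (Pq i k) (Pq j k)) || q_npos (qsub (Pq j k) (Pq i k)))
  && q_lt (mul (wq C) (qsum (fun k => q_pos_part (qsub (Pq i k) (Pq j k))) n))
          (qint ((1 + Z.of_nat (ymax C)) * (dP C * dV C))%cZ))).

Definition check_width :=
  let rows := [seq [seq Vq k j | j <- iota 0 d] | k <- iota 0 n] in
  all (fun y => all (fun x => x =? 0)%cZ y ||
      let w := [seq qdot y r | r <- rows] in
      has (fun wa => has (fun wb => q_npos (qadd (wq C) (qsub wb wa))) w) w)
    (box d (zrange (- Z.of_nat (ymax C))%cZ (ymax C).*2.+1)).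

Definition check :=
  [&& check_scales, check_inverse, check_sum, check_points & check_edges] &&
  [&& check_gaps, check_multipliers, check_stationary & check_coords] &&
  [&& check_lattice, check_coef_bound & check_width].
End Check.

Lemma has_mapP (I : eqType) (S : Type) (f : I -> S) (p : pred S) (s : seq I) :
  has p [seq f x | x <- s] -> exists2 x, x \in s & p (f x).
Proof. by rewrite has_map => /hasP. Qed.

Section CertifiedSimplex.
Context {R : realType}.
Variables (d : nat) (C : cert) (a b : R).
Hypothesis d_gt0 : (0 < d)%N.
Hypothesis a2 : a ^+ 2 = zr (sqA C).
Hypothesis b2 : b ^+ 2 = zr (sqB0 C) + zr (sqB1 C) * a.
Let bd := bnd C.
Hypothesis boundsP : [/\ zr (lo_a bd) <= zr (unitN bd) * a <= zr (hi_a bd),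
  zr (lo_b bd) <= zr (unitN bd) * b <= zr (hi_b bd) &
  zr (lo_ab bd) <= zr (unitN bd) * (a * b) <= zr (hi_ab bd)].
Hypothesis checkP : check d C.

Let ev := qev a b.
Let rV : R := zr (dV C).
Let rP : R := zr (dP C).
Let rL : R := zr (dL C).

Definition cert_vertices : 'M[R]_d.+1 := \matrix_(k, j) (qev a b (Vq d C k j) / zr (dV C)).
Definition cert_width : R := qev a b (wq C) / zr (dV C).
Let V := cert_vertices.
Let W := cert_width.
Let P : 'M[R]_d.+1 := \matrix_(i, k) (ev (Pq d C i k) / rP).
Let L : 'M[R]_d.+1 := \matrix_(i, j) (ev (Lq d C i j) / rL).
Let sigma (i : 'I_d.+1) : 'rV[int]_d := \row_j ((i < d)%N && (j <= i)%N)%:R.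
Let T := vert_values V sigma.

Let ord_eq (i k : 'I_d.+1) : (i == k :> nat) = (i == k). Proof. by []. Qed.

Let scales : [/\ (0 < unitN bd)%cZ, 0 < rV, 0 < rP & 0 < rL].
Proof.
move: checkP => /andP[/andP[/and5P[/and4P[h1 h2 h3 h4] _ _ _ _] _] _].
by split; [exact/Z.ltb_lt|..]; apply: (@zr_lt R 0); exact/Z.ltb_lt.
Qed.

Let N0 : (0 < unitN bd)%cZ. Proof. by case: scales. Qed.
Let rV0 : 0 < rV. Proof. by case: scales. Qed.
Let rP0 : 0 < rP. Proof. by case: scales. Qed.
Let rL0 : 0 < rL. Proof. by case: scales. Qed.

Let q_negP p : q_neg C p -> ev p < 0.
Proof. exact: qlt0P N0 boundsP p. Qed.

Let q_nposP p : q_npos C p -> ev p <= 0.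
Proof. exact: qle0P N0 boundsP p. Qed.

Let q_ltP p q : q_lt C p q -> ev p < ev q.
Proof. by move/q_negP; rewrite /ev qevB subr_lt0. Qed.

Let q_mulP p q : ev (qmul (sqA C) (sqB0 C) (sqB1 C) p q) = ev p * ev q.
Proof. exact: qevM a2 b2 p q. Qed.

Let PV : P *m V = 1%:M.
Proof.
move: checkP => /andP[/andP[/and5P[_ h _ _ _] _] _].
apply/matrixP => i j; have /allbP h' := allbP h (ltn_ord i).
have := qeqbP a b (h' j (ltn_ord j)); rewrite qev_sum => eq.
rewrite !mxE; transitivity ((\sum_(k < d.+1) ev (Pq d C i k) * ev (Vq d C k j)) / (rP * rV)).
  rewrite mulr_suml; apply: eq_bigr => k _; rewrite !mxE -/ev -/rV.
  by field; rewrite !gt_eqF.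
have -> : \sum_(k < d.+1) ev (Pq d C i k) * ev (Vq d C k j) = (i == j)%:R * (rP * rV).
  transitivity (ev (qint (if i == j :> nat then (dP C * dV C)%cZ else 0%cZ))).
    by rewrite -[RHS]eq; apply: eq_bigr => k _; rewrite -[LHS]q_mulP.
  rewrite /ev qev_int; have -> : (i == j :> nat) = (i == j) by [].
  by case: (i == j); rewrite ?mul1r ?mul0r ?zrM.
by rewrite mulfK // gt_eqF // mulr_gt0.
Qed.

Let Vsum k : \sum_j V k j = 1.
Proof.
move: checkP => /andP[/andP[/and5P[_ _ h _ _] _] _].
have := qeqbP a b (allbP h (ltn_ord k)); rewrite qev_sum qev_int => eq.
under eq_bigr do rewrite mxE.
by rewrite -mulr_suml eq divff // gt_eqF.
Qed.

Let P_diag i : P i i = 0.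
Proof.
move: checkP => /andP[/andP[/and5P[_ _ _ h _] _] _].
have /andP[h' _] := allbP h (ltn_ord i).
by rewrite mxE /ev (qeqbP a b h') qev0 mul0r.
Qed.

Let P_gt0 i k : k != i -> 0 < P i k.
Proof.
move: checkP => /andP[/andP[/and5P[_ _ _ h _] _] _] ki.
have /andP[_ /allbP /(_ k (ltn_ord k))] := allbP h (ltn_ord i).
rewrite ord_eq (negbTE ki) /= => /q_negP.
by rewrite /ev qevN oppr_lt0 mxE => ?; rewrite divr_gt0.
Qed.

Let TE k i : T k i = ev (Tq d C k i) / rV.
Proof.
rewrite mxE /dotprod /Tq; case: ifPn => id.
  rewrite /ev qev_sum mulr_suml (big_ord_widen d (fun j => qev a b (Vq d C k j) / rV)) //.
  rewrite [RHS]big_mkcond; apply: eq_bigr => j _; rewrite !mxE /= id ltnS /=.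
  by case: ifP => _; rewrite ?mulr1 ?mulr0.
rewrite /ev qev0 mul0r big1 // => j _.
by rewrite !mxE (negbTE id) /= mulr0.
Qed.

Let edgeE i j : edge T i j = ev (edgeq d C i j) / rV.
Proof. by rewrite /edge !TE /ev !(qevB, qevD); ring. Qed.

Let edgeT i j : i != j -> edge T i j = W.
Proof.
move: checkP => /andP[/andP[/and5P[_ _ _ _ /andP[_ h]] _] _] ij.
have /allbP /(_ j (ltn_ord j)) := allbP h (ltn_ord i).
by rewrite ord_eq (negbTE ij) /= edgeE => /(qeqbP a b); rewrite /ev => ->.
Qed.

Let W_gt0 : 0 < W.
Proof.
move: checkP => /andP[/andP[/and5P[_ _ _ _ /andP[/q_negP h _]] _] _].
by rewrite divr_gt0 //; move: h; rewrite /ev qevN oppr_lt0.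
Qed.

Let gapT i j k : i != j -> k != i -> T k j - T k i < T i j - T i i.
Proof.
move: checkP => /andP[/andP[_ /and4P[h _ _ _]] _] ij ki.
have /allbP /(_ j (ltn_ord j)) /allbP /(_ k (ltn_ord k)) := allbP h (ltn_ord i).
rewrite !ord_eq (negbTE ij) (negbTE ki) /= => /q_ltP.
by rewrite /ev !qevB !TE -!mulrBl ltr_pM2r // invr_gt0.
Qed.

Let symL : L^T = L.
Proof.
move: checkP => /andP[/andP[_ /and4P[_ h _ _]] _].
apply/matrixP => i j; have /and3P[_ /allbP /(_ j (ltn_ord j)) h' _] := allbP h (ltn_ord i).
by rewrite !mxE /ev (qeqbP a b h').
Qed.

Let sumL i : \sum_j L i j = 0.
Proof.
move: checkP => /andP[/andP[_ /and4P[_ h _ _]] _].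
have /and3P[h' _ _] := allbP h (ltn_ord i).
under eq_bigr do rewrite mxE.
by have := qeqbP a b h'; rewrite qev_sum qev0 -mulr_suml => ->; rewrite mul0r.
Qed.

Let negL i j : i != j -> L i j < 0.
Proof.
move: checkP => /andP[/andP[_ /and4P[_ h _ _]] _] ij.
have /and3P[_ _ /allbP /(_ j (ltn_ord j))] := allbP h (ltn_ord i).
rewrite ord_eq (negbTE ij) /= => /q_negP Lij.
by rewrite mxE pmulr_llt0 // invr_gt0.
Qed.

Let PE : P = T *m L + const_mx 1 *m (row ord_max P - row ord_max T *m L).
Proof.
move: checkP => /andP[/andP[_ /and4P[_ _ h _]] _].
apply/matrixP => i k; have /allbP /(_ k (ltn_ord k)) := allbP h (ltn_ord i).
move/(qeqbP a b); rewrite !qevZ qevB qev_sum !zrM -/rL -/rV -/rP -/ev => eq.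
have eq' : (T *m L) i k - (row ord_max T *m L) 0 k = P i k - P ord_max k.
  rewrite !mxE -sumrB.
  apply: (@mulfI _ (rL * rV * rP)); first by rewrite gt_eqF // !mulr_gt0.
  rewrite mulr_sumr; transitivity (rL * rV * (ev (Pq d C i k) - ev (Pq d C d k))).
    rewrite eq mulr_sumr; apply: eq_bigr => l _.
    rewrite q_mulP /ev qevB [row _ _ _ _]mxE !TE [L _ _]mxE -/ev /=.
    by field; rewrite !gt_eqF.
  by field; rewrite gt_eqF.
have -> : P i k = (T *m L) i k + (P ord_max k - (row ord_max T *m L) 0 k).
  by rewrite addrCA eq' addrCA subrr addr0.
rewrite [RHS]mxE [X in _ = _ + X]mxE big_ord1 [const_mx _ _ _]mxE mul1r.
by rewrite !mxE.
Qed.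

Let sigma_inj : injective sigma.
Proof.
have wlog_lt (i j : 'I_d.+1) : (i < j)%N -> sigma i != sigma j.
  move=> ij; apply/eqP => /rowP eq.
  have id : (i < d)%N by rewrite (leq_trans ij) // -ltnS.
  have [jd|jd] := ltnP j d.
    by have := eq (Ordinal jd); rewrite !mxE jd id /= leqnn leqNgt ij.
  by have := eq (Ordinal id); rewrite !mxE id [(j < d)%N]ltnNge jd /= leqnn.
move=> i j eq; apply: val_inj => /=.
by case: (ltngtP i j) => // /wlog_lt; rewrite eq eqxx.
Qed.

Let local_max : exists2 e : R, 0 < e & forall K, convex_body K ->
  lattice_free K -> hausdorff_dist K (simplex V) <= e -> lw K <= W.
Proof.
exact: (simplex_local_max d_gt0 PV Vsum sigma_inj P_diag P_gt0 (ltW W_gt0)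
  edgeT gapT symL sumL negL PE).
Qed.

Let zlist (z : 'rV[int]_d) : seq Z := [seq Z_of_int (z 0 j) | j <- enum 'I_d].

Let zlist_size (z : 'rV[int]_d) : size (zlist z) = d.
Proof. by rewrite size_map size_enum_ord. Qed.

Let zlist_nth (z : 'rV[int]_d) (j : 'I_d) : nth 0%cZ (zlist z) j = Z_of_int (z 0 j).
Proof. by rewrite (nth_map j) ?size_enum_ord // nth_ord_enum. Qed.

Let zlist_dot (z : 'rV[int]_d) (f : nat -> quad) :
  ev (qdot (zlist z) [seq f j | j <- iota 0 d]) = \sum_(j < d) (z 0 j)%:~R * ev (f j).
Proof.
rewrite /ev qev_dot; last by rewrite zlist_size size_map size_iota.
rewrite zlist_size; apply: eq_bigr => j _; rewrite zlist_nth zr_int.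
by rewrite (nth_map 0%N) ?size_iota // nth_iota.
Qed.

Let zlist_box (z : 'rV[int]_d) lo len :
    (forall j, (lo <= Z_of_int (z 0%R j) < lo + Z.of_nat len)%cZ) ->
  zlist z \in box d (zrange lo len).
Proof.
move=> zE; apply: mem_box => // x /mapP[j _ ->].
by have [] := zE j; exact: mem_zrange.
Qed.

Let zr_ltE (x y : Z) : (zr x < zr y :> R) -> (x < y)%cZ.
Proof. by rewrite /zr ltr_int; lia. Qed.

Let bary_int (z : 'rV[int]_d) k : bary P (intvec z) 0 k =
  P ord_max k + \sum_(j < d) (z 0 j)%:~R * (P (widen_ord (leqnSn d) j) k - P ord_max k).
Proof.
rewrite mxE big_ord_recr /= lift_pt_max mulrBl mul1r addrCA; congr (_ + _).
rewrite mulr_suml -sumrB; apply: eq_bigr => j _.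
by rewrite lift_pt_widen mxE mulrBr.
Qed.

Let V_bound k (j : 'I_d) :
  zr (zlo C - 1)%cZ < vert V k 0 j < zr (zlo C + Z.of_nat (zlen C))%cZ.
Proof.
move: checkP => /andP[/andP[_ /and4P[_ _ _ h]] _].
have /allbP /(_ j (ltn_ord j)) /andP[/q_ltP h1 /q_ltP h2] := allbP h (ltn_ord k).
rewrite !mxE /= ltr_pdivlMr // ltr_pdivrMr //.
by move: h1 h2; rewrite /ev !qev_int !zrM => -> ->.
Qed.

Let simplex_lattice_free : lattice_free (simplex V).
Proof.
move: checkP => /andP[_ /and3P[h _ _]].
move=> z /(interior_bary PV Vsum) z_gt0.
have z_box j : (zlo C <= Z_of_int (z 0%R j) < zlo C + Z.of_nat (zlen C))%cZ.
  have zj : (z 0 j)%:~R = \sum_k bary P (intvec z) 0 k * vert V k 0 j :> R.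
    have -> : (z 0 j)%:~R = (intvec z : 'rV[R]_d) 0 j by rewrite mxE.
    rewrite -{1}(baryK PV (intvec z)) comb_vert summxE.
    by apply: eq_bigr => k _; rewrite mxE.
  have b_sum := bary_sum PV Vsum (intvec z).
  have lo : zr (zlo C - 1)%cZ < (z 0 j)%:~R :> R.
    rewrite zj -[X in X < _]mul1r -b_sum mulr_suml.
    apply: ltr_sum => [|k _]; first by apply/hasP; exists ord0; rewrite ?mem_index_enum.
    by rewrite ltr_pM2l //; case/andP: (V_bound k j).
  have hi : (z 0 j)%:~R < zr (zlo C + Z.of_nat (zlen C))%cZ :> R.
    rewrite zj -[X in _ < X]mul1r -b_sum mulr_suml.
    apply: ltr_sum => [|k _]; first by apply/hasP; exists ord0; rewrite ?mem_index_enum.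
    by rewrite ltr_pM2l //; case/andP: (V_bound k j).
  by move: lo hi; rewrite -zr_int => /zr_ltE lo /zr_ltE hi; lia.
rewrite /check_lattice in h; cbv zeta in h; have := allP h _ (@zlist_box _ _ _ z_box).
move=> /has_mapP [k k_n]; move: k_n; rewrite mem_iota /= add0n => k_n /q_nposP.
rewrite /ev /= qevD -/ev zlist_dot => /le_gtF.
have := z_gt0 (Ordinal k_n); rewrite bary_int => pos.
suff -> : 0 < ev (Pq d C d k) + \sum_(j < d) (z 0 j)%:~R * ev (qsub (Pq d C j k) (Pq d C d k)) by [].
suff -> : ev (Pq d C d k) + \sum_(j < d) (z 0 j)%:~R * ev (qsub (Pq d C j k) (Pq d C d k)) =
  (P ord_max (Ordinal k_n) + \sum_(j < d) (z 0 j)%:~R *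
   (P (widen_ord (leqnSn d) j) (Ordinal k_n) - P ord_max (Ordinal k_n))) * rP.
  by rewrite mulr_gt0.
rewrite mulrDl mxE /= divfK ?gt_eqF //; congr (_ + _).
rewrite mulr_suml; apply: eq_bigr => j _; rewrite !mxE /= /ev qevB.
by field; rewrite gt_eqF.
Qed.

Let S0 : simplex V !=set0.
Proof. by exists (vert V ord0); exact: simplex_vert PV Vsum ord0. Qed.

Let S_bnd : dot_bounded (simplex V). Proof. exact: simplex_dot_bounded PV Vsum. Qed.

(** The simplex is its own perturbation, with A = 1 and eta = 0. *)
Let lw_upper : lw (simplex V) <= W.
Proof.
have max0 : ord_max != ord0 :> 'I_d.+1 by rewrite -val_eqE /= -lt0n.
have sigma_neq : sigma ord0 - sigma ord_max != 0.
  by rewrite subr_eq0; apply/eqP => /sigma_inj eq; move: max0; rewrite eq eqxx.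
apply: le_trans (lw_le S0 S_bnd sigma_neq) _.
rewrite -(edgeT max0) -[T]mul1mx.
have [tau tau0 tauE] : exists2 c, 0 < c & forall k i j, `|T k j - T k i| <= c.
  have [c c0 cE] := @finite_upper_bound R ('I_d.+1 * 'I_d.+1 * 'I_d.+1)%type
    (fun x => `|T x.1.1 x.1.2 - T x.1.1 x.2|).
  by exists c => // k i j; exact: (cE (k, j, i)).
apply: (@near_width_le _ _ V P sigma PV Vsum (simplex V) 1%:M 1%:M 0 tau 0) => //.
- by rewrite mulmx1.
- move=> i; rewrite (bigD1 i) //= mxE eqxx big1 ?addr0 // => j /negbTE ji.
  by rewrite mxE eq_sym ji.
- by move=> i j; rewrite mxE subrr normr0.
- by rewrite mulr0 invr_ge0 ler0n.
- by move=> x /(simplexP PV Vsum) xS i; rewrite mulmx1.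
- by move=> i j k ij ki; rewrite addr0 ltW // gapT.
- by rewrite mulr0 mul0r.
Qed.

Let coef_bound (y : 'rV[int]_d) (i j : 'I_d.+1) (m : R) :
    (forall k, m <= dotprod (vert V k) (intvec y) <= m + W) ->
  dotprod (intvec (unit_pt i) : 'rV[R]_d) (intvec y) - dotprod (intvec (unit_pt j)) (intvec y)
    < zr (1 + Z.of_nat (ymax C))%cZ.
Proof.
move: checkP => /andP[_ /and3P[_ h _]] ym.
have /allbP /(_ j (ltn_ord j)) /andP[/allbP sgn lt] := allbP h (ltn_ord i).
rewrite !(dot_bary PV (intvec (unit_pt _))) !bary_unit_pt.
set r := fun k : nat => q_pos_part C (qsub (Pq d C i k) (Pq d C j k)).
have r_ge k : (k < d.+1)%N -> ev (qsub (Pq d C i k) (Pq d C j k)) <= ev (r k) /\ 0 <= ev (r k).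
  move=> kn; rewrite /r /q_pos_part; case: ifPn => [/q_nposP le0|nle].
    by rewrite {2 3}/ev !qev0.
  split => //; have := sgn k kn; rewrite (negbTE nle) /= => /q_nposP.
  by rewrite /ev !qevB; lra.
have r_sum : W * (\sum_(k < d.+1) ev (r k) / rP) < zr (1 + Z.of_nat (ymax C))%cZ.
  have := q_ltP lt; rewrite q_mulP [ev (qint _)]qev_int [ev (qsum _ _)]qev_sum.
  rewrite !zrM -/rP -/rV -/ev => {}lt.
  rewrite -mulr_suml /W /cert_width -/ev -/rV mulf_div ltr_pdivrMr ?mulr_gt0 //.
  by rewrite [rV * rP]mulrC.
apply: le_lt_trans r_sum; rewrite -sumrB.
have -> : \sum_k (row i P 0 k * dotprod (vert V k) (intvec y)
     - row j P 0 k * dotprod (vert V k) (intvec y)) =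
  \sum_k (P i k - P j k) * (dotprod (vert V k) (intvec y) - m).
  transitivity (\sum_k (P i k - P j k) * dotprod (vert V k) (intvec y)
     - (\sum_k (P i k - P j k)) * m).
    have Psum l : \sum_k P l k = 1.
      rewrite -(bary_sum PV Vsum (intvec (unit_pt l))).
      by apply: eq_bigr => k _; rewrite bary_unit_pt [RHS]mxE.
    have -> : \sum_k (P i k - P j k) = 0 by rewrite sumrB !Psum subrr.
    rewrite mul0r subr0.
    by apply: eq_bigr => k _; rewrite mulrBl ![row _ _ _ _]mxE.
  by rewrite mulr_suml -sumrB; apply: eq_bigr => k _; rewrite mulrBr.
rewrite mulr_sumr; apply: ler_sum => k _.
have /andP[yk1 yk2] := ym k; have [r1 r2] := r_ge k (ltn_ord k).
have Pr : P i k - P j k <= ev (r k) / rP.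
  by rewrite !mxE -mulrBl ler_pM2r ?invr_gt0 // -qevB.
apply: le_trans (_ : ev (r k) / rP * (dotprod (vert V k) (intvec y) - m) <= _).
  by rewrite ler_wpM2r // subr_ge0.
by rewrite mulrC ler_wpM2r ?divr_ge0 ?(ltW rP0) //; lra.
Qed.

(** A width below W bounds the coefficients of y, so that the finite check finds
two vertices whose values differ by W at least. *)
Let width_lower (y : 'rV[int]_d) : y != 0 -> W <= width (simplex V) y.
Proof.
move=> y0; rewrite leNgt; apply/negP => yW.
pose w k : R := dotprod (vert V k) (intvec y).
have w_lt k l : w k - w l < W.
  apply: le_lt_trans yW; apply: width_ge => //; exact: simplex_vert PV Vsum _.
have [m _ mmin] : exists2 m, true & forall k, w m <= w k.
  by case: (@arg_minP _ R 'I_d.+1 ord0 predT w) => // m _ mm; exists m => // k; exact: mm.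
have wm k : w m <= w k <= w m + W by rewrite mmin /=; have := w_lt k m; lra.
have coordE (j : 'I_d) : dotprod (intvec (unit_pt (widen_ord (leqnSn d) j)) : 'rV[R]_d) (intvec y)
    = (y 0 j)%:~R.
  rewrite /dotprod (bigD1 j) //= !mxE eqxx mul1r big1 ?addr0 // => l lj.
  by rewrite !mxE /= (inj_eq val_inj) (negbTE lj) mul0r.
have coord_max : dotprod (intvec (unit_pt ord_max) : 'rV[R]_d) (intvec y) = 0.
  by rewrite /dotprod big1 // => l _; rewrite !mxE /= ltn_eqF // mul0r.
have y_box j : (- Z.of_nat (ymax C) <= Z_of_int (y 0%R j)
    < - Z.of_nat (ymax C) + Z.of_nat (ymax C).*2.+1)%cZ.
  have := @coef_bound y (widen_ord (leqnSn d) j) ord_max _ wm.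
  have := @coef_bound y ord_max (widen_ord (leqnSn d) j) _ wm.
  rewrite coordE coord_max subr0 sub0r -zr_int -zrN => /zr_ltE h1 /zr_ltE h2; lia.
move: checkP => /andP[_ /and3P[_ _ h]].
rewrite /check_width in h; cbv zeta in h.
have /orP[/allP all0|] := allP h _ (@zlist_box _ _ _ y_box).
  move: y0 => /eqP; apply; apply/rowP => j; rewrite mxE.
  have /all0 : Z_of_int (y 0 j) \in zlist y by apply: map_f; rewrite mem_enum.
  by move/Z.eqb_eq/(congr1 int_of_Z); rewrite Z_of_intK.
rewrite -map_comp => /has_mapP[k kn /has_mapP[l ln]].
move: kn ln; rewrite !mem_iota /= !add0n => kn ln /q_nposP.
rewrite /ev qevD qevB -/ev !zlist_dot.
have wE k' (kn' : (k' < d.+1)%N) :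
    \sum_(j < d) (y 0 j)%:~R * ev (Vq d C k' j) = rV * w (Ordinal kn').
  rewrite mulr_sumr; apply: eq_bigr => j _; rewrite !mxE /= -/ev -/rV.
  by field; rewrite gt_eqF.
have -> : ev (wq C) = rV * W by rewrite mulrC divfK // gt_eqF.
rewrite (wE k kn) (wE l ln) -mulrBr -mulrDr pmulr_rle0 //.
by have := w_lt (Ordinal kn) (Ordinal ln); lra.
Qed.

Theorem certified_simplex : let S := simplex cert_vertices in
  [/\ is_simplex S, lattice_free S, lw S = cert_width & local_maximizer_lw S].
Proof.
have lwS : lw (simplex V) = W.
  apply/eqP; rewrite eq_le lw_upper; apply: lb_le_inf.
    have max0 : ord_max != ord0 :> 'I_d.+1 by rewrite -val_eqE /= -lt0n.
    exists (width (simplex V) (sigma ord0 - sigma ord_max)).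
    exists (sigma ord0 - sigma ord_max) => //=.
    by rewrite subr_eq0; apply/eqP => /sigma_inj eq; move: max0; rewrite eq eqxx.
  by move=> _ [y /= y0 <-]; exact: width_lower.
split => //; first exact: simplex_is_simplex PV Vsum.
have [e e0 eE] := local_max; exists e => // K K1 K2 K3.
by rewrite lwS; exact: eE.
Qed.

End CertifiedSimplex.

(** * The two simplices *)

Section Cyclic.
Context {R : realType} {d : nat}.

Lemma cshiftE (v : 'rV[R]_d.+1) k (j : 'I_d.+1) : (k <= d.+1)%N ->
  cshift k v 0 j = v 0 (inord ((j + d.+1 - k) %% d.+1)).
Proof.
elim: k j => [|k IH] j kd.
  by rewrite subn0 modnDr modn_small // inord_val.
rewrite /cshift iterS mxE -/(cshift k v) IH 1?ltnW //; congr (v 0 (inord _)).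
rewrite /= -addnBA 1?ltnW // modnDml.
have -> : ((j + d.+1).-1 + (d.+1 - k) = j + d.+1 - k.+1 + d.+1)%N by lia.
by rewrite modnDr.
Qed.

Lemma simplex_cyclic (v : 'rV[R]_d.+1) (V : 'M[R]_d.+1) :
  (forall k : 'I_d.+1, row k V = cshift k.+1 v) ->
  @proj_first R d @` cyclic_hull v = simplex V.
Proof.
move=> rowV; congr (_ @` _); rewrite /cyclic_hull; congr convhull.
by apply/funext => k; rewrite rowV.
Qed.

End Cyclic.


Lemma simplex_cyclic_cert (d : nat) (C : cert) (R : realType) (a b : R) (v : 'rV[R]_d.+1) :
  (forall j : 'I_d.+1, v 0 j = qev a b (nth q0 (vq C) j) / zr (dV C)) ->
  @proj_first R d @` cyclic_hull v = simplex (cert_vertices d C a b).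
Proof.
move=> vE; apply: simplex_cyclic => k; apply/rowP => j.
rewrite cshiftE ?ltn_ord // vE !mxE inordK ?ltn_mod //.
Qed.

Lemma sqrt_bounds (R : rcfType) (x lo hi : R) : 0 <= lo -> 0 <= hi ->
  lo ^+ 2 <= x -> x <= hi ^+ 2 -> lo <= Num.sqrt x <= hi.
Proof.
move=> lo0 hi0 lox xhi.
by rewrite -[lo]ger0_norm // -[hi]ger0_norm // -!sqrtr_sqr !ler_wsqrtr.
Qed.

Lemma sqrt_eq (R : rcfType) (x y : R) : 0 <= y -> y ^+ 2 = x -> Num.sqrt x = y.
Proof. by move=> y0 <-; rewrite sqrtr_sqr ger0_norm. Qed.

Lemma zr_pos (R : realDomainType) (p : positive) : zr (Z.pos p) = (Pos.to_nat p)%:R :> R.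
Proof. by []. Qed.

Lemma zr_neg (R : realDomainType) (p : positive) : zr (Z.neg p) = - (Pos.to_nat p)%:R :> R.
Proof. by rewrite -zr_pos -zrN. Qed.

Lemma zr_0 (R : realDomainType) : zr 0%cZ = 0 :> R.
Proof. by []. Qed.

Ltac zr_numerals :=
  rewrite ?zr_pos ?zr_neg ?zr_0;
  repeat match goal with |- context [Pos.to_nat ?p] =>
    let n := eval vm_compute in (Pos.to_nat p) in change (Pos.to_nat p) with n
  end.

(** Here a = sqrt 5 and b = sqrt (5 - 2 a); the other radicals that occur lie in
the same field: sqrt (5 + 2 a) = b (a + 2) and sqrt (10 + 2 a) = b (a + 3).  P is
the inverse of the matrix of the vertices, and L is found by solving P = T L
up to a common shift of the rows. *)
Definition cert4 := Cert 5 5 (-2) (Bounds 10 22 23 7 8 16 17)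
  [:: Quad 7 (-2) 6 2; Quad (-3) 4 (-4) 0; Quad 7 (-4) 6 0; Quad (-3) 4 (-4) 0;
      Quad (-3) (-2) (-4) (-2)] 5
  [:: Quad 0 0 0 0; Quad 5 1 (-3) (-1); Quad 5 1 (-1) (-1); Quad 5 0 1 0; Quad 5 (-2) 3 2] 20
  [:: Quad 0 (-4) 8 4; Quad (-5) 1 3 0; Quad 5 1 (-7) (-2); Quad 5 1 (-7) (-2); Quad (-5) 1 3 0] 40
  (Quad 10 0 10 4) (-2) 5 2.

Lemma check4 : check 4 cert4. Proof. by vm_compute. Qed.

Lemma delta4_maximizer (R : realType) :
  let S4 : set 'rV[R]_4 := @proj_first R 4 @` Delta4 R in
  [/\ is_simplex S4, lattice_free S4,
      lw S4 = 2 + 2 * Num.sqrt (1 + 2 / Num.sqrt 5) &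
      local_maximizer_lw S4].
Proof.
cbv zeta.
pose a : R := Num.sqrt 5.
have a2 : a ^+ 2 = 5 by rewrite sqr_sqrtr.
have /andP[a_lo a_hi] : 111 / 50 <= a <= 56 / 25 by apply: sqrt_bounds; lra.
pose b : R := Num.sqrt (5 - 2 * a).
have b2 : b ^+ 2 = 5 - 2 * a by rewrite sqr_sqrtr //; lra.
have /andP[b_lo b_hi] : 7 / 10 <= b <= 8 / 10 by apply: sqrt_bounds; lra.
have a0 : a != 0 by rewrite gt_eqF //; lra.
have sqrt_plus : Num.sqrt (5 + 2 * a) = b * (a + 2).
  by apply: sqrt_eq; [apply: mulr_ge0; lra|rewrite exprMn b2; ring: a2].
have sqrt_10 : Num.sqrt (10 + 2 * a) = b * (a + 3).
  by apply: sqrt_eq; [apply: mulr_ge0; lra|rewrite exprMn b2; ring: a2].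
have sqrt_w : Num.sqrt (1 + 2 / a) = b * (1 + 2 / 5 * a).
  apply: sqrt_eq; first by apply: mulr_ge0; lra.
  have -> : 2 / a = 2 / 5 * a.
    by rewrite -[X in _ = 2 / X * _]a2; field.
  by rewrite exprMn b2; field: a2.
have -> : @proj_first R 4 @` Delta4 R = simplex (cert_vertices 4 cert4 a b).
  apply: simplex_cyclic_cert => j; rewrite mxE -/a -/b sqrt_plus sqrt_10.
  rewrite /qev; case: j => [[|[|[|[|[|j]]]]] jn] //=; zr_numerals.
  - by field.
  - by field.
  - by field.
  - by field.
  - by field.
have -> : 2 + 2 * Num.sqrt (1 + 2 / Num.sqrt 5) = cert_width cert4 a b.
  by rewrite -/a sqrt_w /cert_width /=; zr_numerals; field.
apply: certified_simplex.
- by [].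
- by rewrite a2.
- by rewrite b2 /=; zr_numerals; ring.
- have /andP[ab_lo ab_hi] : 16 / 10 <= a * b <= 17 / 10.
    have <- : Num.sqrt (25 - 10 * a) = a * b.
      by apply: sqrt_eq; [apply: mulr_ge0; lra|rewrite exprMn a2 b2; ring].
    by apply: sqrt_bounds; lra.
  by move=> /=; zr_numerals; split; apply/andP; split; lra.
- exact: check4.
Qed.

(** Here a = sqrt 3, and b = 0. *)
Definition cert5 := Cert 3 0 0 (Bounds 10 17 18 0 0 0 0)
  [:: Quad 57 (-7) 0 0; Quad (-30) 24 0 0; Quad 27 (-11) 0 0; Quad 27 (-11) 0 0;
      Quad (-30) 24 0 0; Quad (-33) (-19) 0 0] 18
  [:: Quad 0 0 0 0; Quad 39 9 0 0; Quad 69 5 0 0; Quad 120 (-16) 0 0; Quad 99 1 0 0;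
      Quad 99 1 0 0] 426
  [:: Quad 1065 (-142) 0 0; Quad 60 (-79) 0 0; Quad (-177) (-19) 0 0; Quad (-831) 338 0 0;
     Quad (-177) (-19) 0 0; Quad 60 (-79) 0 0] 15123
  (Quad 90 12 0 0) (-3) 6 2.

Lemma check5 : check 5 cert5. Proof. by vm_compute. Qed.

Lemma delta5_maximizer (R : realType) :
  let S5 : set 'rV[R]_5 := @proj_first R 5 @` Delta5 R in
  [/\ is_simplex S5, lattice_free S5, lw S5 = 5 + 2 / Num.sqrt 3 &
      local_maximizer_lw S5].
Proof.
pose s : R := Num.sqrt 3.
have s2 : s ^+ 2 = 3 by rewrite sqr_sqrtr.
have /andP[s_lo s_hi] : 17 / 10 <= s <= 18 / 10 by apply: sqrt_bounds; lra.
have -> : @proj_first R 5 @` Delta5 R = simplex (cert_vertices 5 cert5 s 0).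
  apply: simplex_cyclic_cert => j; rewrite mxE -/s.
  rewrite /qev; case: j => [[|[|[|[|[|[|j]]]]]] jn] //=; zr_numerals.
  - by field.
  - by field.
  - by field.
  - by field.
  - by field.
  - by field.
have -> : 5 + 2 / Num.sqrt 3 = cert_width cert5 s 0.
  rewrite /cert_width /= -/s; zr_numerals.
  have -> : 2 / s = 2 / 3 * s.
    rewrite -[in X in _ / X * _]s2; field.
    by rewrite gt_eqF //; lra.
  by field.
apply: certified_simplex.
- by [].
- by rewrite s2.
- by rewrite /=; zr_numerals; ring.
- move=> /=; zr_numerals; split; apply/andP; split; lra.
- exact: check5.
Qed.

Theorem theorem2 (R : realType) :
  let S4 : set 'rV[R]_4 := @proj_first R 4 @` Delta4 R in
  let S5 : set 'rV[R]_5 := @proj_first R 5 @` Delta5 R in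
  [/\ is_simplex S4, lattice_free S4,
      lw S4 = 2 + 2 * Num.sqrt (1 + 2 / Num.sqrt 5) &
      local_maximizer_lw S4] /\
  [/\ is_simplex S5, lattice_free S5,
      lw S5 = 5 + 2 / Num.sqrt 3 &
      local_maximizer_lw S5].
Proof. by split; [exact: delta4_maximizer | exact: delta5_maximizer]. Qed.
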